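(* Let $s,t\ge1$, let $\beta_1,\dotsc,\beta_s$ be positive integers, and let \[ F_{\boldsymbol\beta,q}[s;t]=\prod_{1\le i<j\le s}\Big(\frac{z_i}{z_j};q\Big)_{\beta_i}\Big(\frac{qz_j}{z_i};q\Big)_{\beta_j}\prod_{i=1}^s\prod_{j=1}^t\Big(\frac{z_i}{w_j};q\Big)_{\beta_i}^{-1}, \] expanded as a formal series. For $\mathbf{k}=(k_1,\dotsc,k_s)\in\mathbb{Z}^s$ and $\mathbf{m}=(m_1,\dotsc,m_t)\in\mathbb{Z}_{\ge0}^t$, if the monomial $z_1^{k_1}\dotsm z_s^{k_s}w_1^{-m_1}\dotsm w_t^{-m_t}$ appears in the expansion of $F_{\boldsymbol\beta,q}[s;t]$, then $\mathbf{k}^+\ge\mathbf{m}^+$. Moreover, in the case that all $\beta_i$ equal a common positive integer $\beta$, if $\lambda$ is a partition with $s=t=l(\lambda)$, then the coefficient of $z_1^{\lambda_1}\dotsm z_s^{\lambda_s}w_1^{-\lambda_1}\dotsm w_s^{-\lambda_s}$ in $F_{\boldsymbol\beta,q}[s;t]$ is \[ c_\lambda=q^{\beta[l(\lambda)^2-\sum_{i\ge1}m_i(\lambda)^2]/2}\prod_{i\ge1}\frac{(q^\beta;q^\beta)_{m_i(\lambda)}}{(1-q^\beta)^{m_i(\lambda)}}\prod_{i=1}^{l(\lambda)}\frac{(q^\beta;q)_{\lambda_i+(s-i)\beta}}{(q;q)_{\lambda_i+(s-i)\beta}}. \]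
   Context: $(z;q)_n=(1-z)(1-qz)\dotsm(1-q^{n-1}z)$, $(z;q)_0=1$. The expansion is obtained by expanding each factor $(1-q^bz_i/w_j)^{-1}$ as $\sum_{m\ge0}(q^bz_i/w_j)^m$ (the region $|q^bz_i/w_j|<1$). For a partition $\lambda$, $l(\lambda)$ is its number of nonzero parts and $m_i(\lambda)$ the multiplicity of $i$ in $\lambda$. For $a\in\mathbb{Z}^n$, $a^+$ denotes the vector obtained by rearranging $a_1,\dotsc,a_n$ in weakly decreasing order; for $a\in\mathbb{Z}^n$, $b\in\mathbb{Z}^m$, write $a\ge b$ if $a_1+\dotsb+a_i\ge b_1+\dotsb+b_i$ for all $i\ge1$, where vectors are padded with zeros beyond their length. *)

(* Defs.v *)
From HB Require Import structures.
From mathcomp Require Import all_boot all_order all_algebra.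
From mathcomp Require Import fraction.
Set Implicit Arguments.
Unset Strict Implicit.
Unset Printing Implicit Defensive.
Import Order.TTheory GRing.Theory Num.Theory.
Local Open Scope ring_scope.

Notation "x %:F" := (@FracField.tofrac _ x) : ring_scope.

(* Exponent vectors of Laurent monomials z_1^a_1...z_s^a_s w_1^b_1...w_t^b_t *)
Definition mon (s t : nat) := ({ffun 'I_s -> int} * {ffun 'I_t -> int})%type.
Definition mon0 (s t : nat) : mon s t := ([ffun=> 0], [ffun=> 0]).
Definition monM s t (a b : mon s t) : mon s t :=
  ([ffun i => a.1 i + b.1 i], [ffun j => a.2 j + b.2 j]).
Definition monX s t (n : nat) (a : mon s t) : mon s t :=
  ([ffun i => a.1 i *+ n], [ffun j => a.2 j *+ n]).

Definition zz s t (i j : 'I_s) : mon s t :=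
  ([ffun k => (k == i)%:Z - (k == j)%:Z], [ffun=> 0]).
Definition zw s t (i : 'I_s) (j : 'I_t) : mon s t :=
  ([ffun k => (k == i)%:Z], [ffun l => - (l == j)%:Z]).

(* A Laurent polynomial in z, w with coefficients in Z[q], as a formal
   finite sum (list) of terms (coefficient, monomial). *)
Definition lpoly s t := seq ({poly int} * mon s t).
Definition lp1 s t : lpoly s t := [:: (1, mon0 s t)].
Definition lpM s t (p r : lpoly s t) : lpoly s t :=
  [seq (x.1 * y.1, monM x.2 y.2) | x <- p, y <- r].
Definition lpprod s t (ps : seq (lpoly s t)) : lpoly s t :=
  foldr (@lpM s t) (lp1 s t) ps.
Definition lpcoef s t (p : lpoly s t) (e : mon s t) : {poly int} :=
  \sum_(x <- p | x.2 == e) x.1.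

Definition lp_poch s t (c : {poly int}) (x : mon s t) (n : nat) : lpoly s t :=
  lpprod [seq [:: (1, mon0 s t); (- ('X ^+ b * c), x)] | b <- iota 0 n].
(* (x ; q)_n^{-1} = prod_{b<n} sum_{m>=0} (q^b x)^m, each geometric series
   truncated at degree N *)
Definition lp_ipoch s t (x : mon s t) (n N : nat) : lpoly s t :=
  lpprod [seq [seq ('X ^+ (b * m), monX m x) | m <- iota 0 N.+1] | b <- iota 0 n].

Definition F_trunc s (beta : 'I_s -> nat) t (N : nat) : lpoly s t :=
  lpprod
    (flatten [seq [seq lpM (lp_poch 1 (zz t i j) (beta i))
                           (lp_poch 'X (zz t j i) (beta j))
                     | j <- filter (fun j : 'I_s => (i < j)%N) (enum 'I_s)] | i <- enum 'I_s]
     ++ flatten [seq [seq lp_ipoch (zw i j) (beta i) N | j <- enum 'I_t]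
                | i <- enum 'I_s]).

(* Coefficient (in Z[q]) of the monomial e in the expansion of F_{beta,q}[s;t].
   A term m of a geometric series in z_i/w_j contributes w_j^{-m} and no other
   factor involves w; hence only terms with m <= |e_w(j)| can contribute, and
   the truncation at N = sum_j |e_w(j)| computes the exact coefficient. *)
Definition Fcoef s (beta : 'I_s -> nat) t (e : mon s t) : {poly int} :=
  lpcoef (F_trunc beta t (\sum_(j < t) `|e.2 j|)%N) e.

Definition dec_sort (a : seq int) : seq int := sort (fun x y : int => y <= x) a.
Definition dominates (a b : seq int) : Prop :=
  forall n : nat, \sum_(l < n) nth 0 b l <= \sum_(l < n) nth 0 a l.

Definition mult s (lam : 'I_s -> nat) (i : nat) : nat := #|[pred j | lam j == i]|.

Definition qpoch (K : comPzRingType) (x q : K) (n : nat) : K :=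
  \prod_(i < n) (1 - q ^+ i * x).

Definition clam s (b : nat) (lam : 'I_s -> nat) : {fraction {poly int}} :=
  let q : {fraction {poly int}} := ('X : {poly int})%:F in
  let L := (\sum_(j < s) lam j)%N in
  q ^+ ((b * (s ^ 2 - \sum_(1 <= i < L.+1) (mult lam i) ^ 2)) %/ 2)%N
  * (\prod_(1 <= i < L.+1)
       (qpoch (q ^+ b) (q ^+ b) (mult lam i) / (1 - q ^+ b) ^+ (mult lam i)))
  * (\prod_(i < s)
       (qpoch (q ^+ b) q (lam i + (s - 1 - i) * b)%N
        / qpoch q q (lam i + (s - 1 - i) * b)%N)).

(* Main.v *)
Require Import Defs.
From HB Require Import structures.
From mathcomp Require Import all_boot all_order all_algebra.
From mathcomp Require Import fraction.
From mathcomp Require Import mpoly ring lra zify.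
Set Implicit Arguments.
Unset Strict Implicit.
Unset Printing Implicit Defensive.
Import Order.TTheory GRing.Theory Num.Theory.
Local Open Scope ring_scope.

(** The coefficient of [w^-m] in [F] is the q-Dyson product times
    [h_(m_1) ... h_(m_t)], where [h_m] is the complete homogeneous symmetric
    function of the letters [q^b z_i], [b < beta_i].  By partial fractions
    [h_m] is a sum over these letters of [(q^b z_i)^m] divided by the product of
    [1 - q^(b'-b) z_j / z_i] over the other letters.  The factors with [j <> i]
    divide the part of the q-Dyson product that involves [z_i], leaving a
    polynomial in the ratios [z_i / z_j], while the rest is the q-Dyson product
    in the remaining variables.  So extracting one [w] removes one variable
    [z_i], which picks up degree at least [m]; iterating over the largest parts
    of [m] gives dominance.  For [k = m = lambda] only the constant terms of
    these polynomials survive, and only for [lambda_i] maximal; the sum over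
    the letters of [z_i] is then again a complete homogeneous function, at
    [1, q, ..., q^(beta-1)], evaluated by the q-binomial theorem.  *)

(** * Partial fractions of complete homogeneous functions *)

Section TruncatedSeries.
Variable F : fieldType.
Implicit Types (x y : F) (l : seq F).

Definition geom (N : nat) x : {poly F} := \poly_(c < N.+1) x ^+ c.

Lemma geomM N x : geom N x * (1 - x *: 'X) = 1 - x ^+ N.+1 *: 'X^(N.+1).
Proof.
rewrite /geom poly_def mulrC -exprZn -[1 in RHS](expr1n _ N.+1).
rewrite subrXX; congr (_ * _); apply: eq_bigr => i _.
by rewrite expr1n mul1r exprZn.
Qed.

(** Controls truncation errors: with [n = N.+1] such a factor does not affect coefficients up to
    order [N]. *)
Lemma prod_one_sub_Xn (r : seq F) (P : pred F) n (c : F -> F) :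
  exists V, \prod_(y <- r | P y) (1 - c y *: 'X^n) = 1 + V * 'X^n.
Proof.
elim: r => [|y r [V IH]]; first by exists 0; rewrite big_nil mul0r addr0.
rewrite big_cons IH; case: (P y); last by exists V.
exists (V - (c y)%:P - (c y)%:P * V * 'X^n).
by rewrite -mul_polyC; ring.
Qed.

(** The difference of the two sides has degree less than [size l] and vanishes at the [size l]
    distinct points [x^-1]: there every summand except that of [x] contains the zero factor
    [1 - x *: 'X], and the summand of [x] equals 1. *)
Lemma lagrange_one l : uniq l -> l != [::] -> 0 \notin l ->
  \sum_(x <- l) (\prod_(y <- l | y != x) (1 - y / x)^-1)
     *: \prod_(y <- l | y != x) (1 - y *: 'X) = 1 :> {poly F}.
Proof.
move=> Ul nl n0; set U := (LHS); apply/eqP; rewrite -subr_eq0; apply/eqP.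
have sl : (0 < size l)%N by case: l nl {U Ul n0}.
have szf (y : F) : (size (1 - y *: 'X : {poly F})%R <= 2)%N.
  rewrite (leq_trans (size_polyD _ _)) // size_polyN size_poly1.
  by rewrite geq_max /= (leq_trans (size_scale_leq _ _)) // size_polyX.
have szp (r : seq F) (P : pred F) :
    (size (\prod_(y <- r | P y) (1 - y *: 'X) : {poly F})%R <= (count P r).+1)%N.
  elim: r => [|y r IH]; first by rewrite big_nil size_poly1.
  rewrite big_cons /=; case: (P y) => //=.
  apply: leq_trans (size_polyMleq _ _) _.
  have aux a b c : (a <= 2 -> b <= c.+1 -> (a + b).-1 <= (1 + c).+1)%N by lia.
  exact: aux (szf y) IH.
apply: (@roots_geq_poly_eq0 _ _ [seq x^-1 | x <- l]).
- apply/allP => _ /mapP [x xl ->]; rewrite rootE hornerD hornerN hornerC subr_eq0.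
  apply/eqP; rewrite /U horner_sum (bigD1_seq x) //= [X in _ + X]big1_seq ?addr0.
    rewrite hornerZ horner_prod -big_split big1_seq //= => y /andP [yx yl].
    rewrite hornerD hornerN hornerZ hornerX hornerC mulVf // subr_eq0.
    have x0 : x != 0 by apply: contraNneq n0 => <-.
    by apply: contra_neq yx => /(congr1 ( *%R^~ x)); rewrite mul1r divfK.
  move=> x' /andP [x'x x'l]; rewrite hornerZ horner_prod [X in _ * X](big_rem x) //= eq_sym x'x.
  rewrite hornerD hornerN hornerZ hornerX hornerC mulfV ?subrr ?mul0r ?mulr0 //.
  by apply: contraNneq n0 => <-.
- rewrite map_inj_uniq //; exact: invr_inj.
rewrite size_map (leq_trans (size_polyD _ _)) // size_polyN size_poly1 geq_max sl andbT.
apply: leq_trans (size_sum _ _ _) _.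
apply/bigmax_leqP_seq => x xl _; apply: leq_trans (size_scale_leq _ _) _.
apply: leq_trans (szp _ _) _.
rewrite -(count_predC (pred1 x) l) count_uniq_mem // xl add1n ltnS.
by apply: sub_count => y.
Qed.

(** Multiply the product by [lagrange_one]. In the summand of [x], each [geom N y] with [y != x]
    meets [1 - y *: 'X] and becomes 1 up to order [N], so only [geom N x] contributes. *)
Lemma coef_prod_geom_lagrange N l m : uniq l -> l != [::] -> 0 \notin l ->
  (m <= N)%N ->
  (\prod_(x <- l) geom N x)`_m
  = \sum_(x <- l) x ^+ m * \prod_(y <- l | y != x) (1 - y / x)^-1.
Proof.
move=> Ul nl n0 mN; rewrite -[\prod_(x <- l) _]mulr1 -[X in _ * X](lagrange_one Ul nl n0).
rewrite big_distrr coef_sum /=; apply: eq_big_seq => x xl.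
rewrite -scalerAr coefZ mulrC; congr (_ * _).
rewrite (bigD1_seq x) //= -mulrA -big_split /=.
rewrite (eq_bigr (fun y => 1 - y ^+ N.+1 *: 'X^(N.+1))); last by move=> y _; rewrite geomM.
have [V ->] := prod_one_sub_Xn l (fun y => y != x) N.+1 (fun y => y ^+ N.+1).
by rewrite mulrDr mulr1 coefD mulrA coefMXn ltnS mN addr0 coef_poly ltnS mN.
Qed.

(** Adding the letter [q ^+ n] gives the recursion h_(m+1)(n+1) = h_(m+1)(n) + q^n h_m(n+1) for the
    coefficients. The closed form satisfies it too, whence a double induction on [n] and [m]. *)
Lemma coef_prod_geom_qbinomial (q : F) N n m :
  (forall k, q ^+ k.+1 != 1) -> (m <= N)%N ->
  (\prod_(b < n) geom N (q ^+ b))`_m = qpoch (q ^+ n) q m / qpoch q q m.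
Proof.
move=> q1; have nz k : 1 - q ^+ k.+1 != 0 by rewrite subr_eq0 eq_sym.
have qS x k : qpoch x q k.+1 = qpoch x q k * (1 - q ^+ k * x) by rewrite /qpoch big_ord_recr.
have q0 x : qpoch x q 0 = 1 by rewrite /qpoch big_ord0.
have qnz k : qpoch q q k != 0.
  by apply/prodf_neq0 => i _; rewrite -exprSr.
have ql k n' : (1 - q ^+ n') * qpoch (q ^+ n'.+1) q k = qpoch (q ^+ n') q k.+1.
  rewrite /qpoch big_ord_recl mul1r; congr (_ * _); apply: eq_bigr => i _.
  by rewrite lift0 exprS exprSr -mulrA.
elim: n m => [|n IH] m.
  rewrite big_ord0 coef1; case: m => [|m] _; first by rewrite !q0 divr1.
  by rewrite -ql expr0 subrr mul0r mul0r.
elim: m => [|m IHm] mN.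
  rewrite coef0_prod !q0 divr1 big1 // => i _.
  by rewrite coef_poly.
have E : (\prod_(b < n.+1) geom N (q ^+ b)) * (1 - q ^+ n *: 'X)
    = \prod_(b < n) geom N (q ^+ b) * (1 - q ^+ n ^+ N.+1 *: 'X^(N.+1)).
  by rewrite big_ord_recr /= -mulrA geomM.
move/(congr1 (fun p : {poly F} => p`_m.+1)): E.
rewrite !mulrBr !mulr1 !coefB -!scalerAr !coefZ coefMX coefMXn /= ltnS mN mulr0 subr0.
rewrite IHm ?IH //; last exact: ltnW.
move/eqP; rewrite subr_eq => /eqP ->.
rewrite -ql !qS; move: (qnz m) (nz m).
set a := qpoch q q m; set c := qpoch _ _ _ => a0.
rewrite exprS => m0; rewrite -exprSr !exprS; field.
by rewrite a0 m0.
Qed.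

End TruncatedSeries.

(** * Combinations of monomials with constrained exponents *)

Section Span.
Variables (K Om : fieldType) (io : {rmorphism K -> Om}) (G : zmodType).
Variable chi : G -> Om.
Hypothesis chiD : forall a b, chi (a + b) = chi a * chi b.
Hypothesis chi0 : chi 0 = 1.
Implicit Types (S : G -> Prop) (f g : Om).

(** Support conditions are expressed by the existence of a representation, so that their closure
    properties hold for any multiplicative [chi]; linear independence comes in through
    [mspan_coef]. *)
Definition mspan S f := exists2 l : seq (K * G),
  forall x, x \in l -> S x.2 & f = \sum_(x <- l) io x.1 * chi x.2.

Lemma mspan0 S : mspan S 0.
Proof. by exists [::]; rewrite ?big_nil. Qed.

Lemma mspanD S f g : mspan S f -> mspan S g -> mspan S (f + g).
Proof.
move=> [l lS ->] [r rS ->]; exists (l ++ r); last by rewrite big_cat.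
by move=> x; rewrite mem_cat => /orP [/lS|/rS].
Qed.

Lemma mspanW S S' f : (forall a, S a -> S' a) -> mspan S f -> mspan S' f.
Proof. by move=> SS [l lS ->]; exists l => // x /lS /SS. Qed.

Lemma mspan_chi S c a : S a -> mspan S (io c * chi a).
Proof.
by move=> Sa; exists [:: (c, a)]; rewrite ?big_seq1 // => x; rewrite inE => /eqP ->.
Qed.

Lemma mspan_sum S I (r : seq I) (P : pred I) (F : I -> Om) :
  (forall i, P i -> mspan S (F i)) -> mspan S (\sum_(i <- r | P i) F i).
Proof. by move=> H; apply: (big_ind (mspan S)) => //; [exact: mspan0|exact: mspanD]. Qed.

Lemma mspan_sum_seq S (I : eqType) (r : seq I) (P : pred I) (F : I -> Om) :
  (forall i, i \in r -> P i -> mspan S (F i)) -> mspan S (\sum_(i <- r | P i) F i).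
Proof.
move=> H; rewrite big_seq_cond; apply: mspan_sum => i /andP [ir Pi]; exact: H.
Qed.

Lemma mspanM S1 S2 S f g : (forall a b, S1 a -> S2 b -> S (a + b)) ->
  mspan S1 f -> mspan S2 g -> mspan S (f * g).
Proof.
move=> SS [l lS ->] [r rS ->]; rewrite big_distrl; apply: mspan_sum_seq => x xl _.
rewrite big_distrr; apply: mspan_sum_seq => y yr _ /=.
by rewrite mulrACA -rmorphM -chiD; apply: mspan_chi; apply: SS; [exact: lS|exact: rS].
Qed.

Lemma mspan_const S c : S 0 -> mspan S (io c).
Proof. by move=> S0; rewrite -[io c]mulr1 -chi0; exact: mspan_chi. Qed.

Lemma mspanZ S c f : mspan S f -> mspan S (io c * f).
Proof.
move=> Sf; apply: (@mspanM (fun a => a = 0) S) Sf; first by move=> a b -> ; rewrite add0r.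
exact: mspan_const.
Qed.

Lemma mspanN S f : mspan S f -> mspan S (- f).
Proof. by rewrite -mulN1r -(rmorphN1 io); exact: mspanZ. Qed.

Lemma mspanB S f g : mspan S f -> mspan S g -> mspan S (f - g).
Proof. by move=> Sf Sg; apply: mspanD => //; exact: mspanN. Qed.

Lemma mspan_prod S I (r : seq I) (P : pred I) (F : I -> Om) :
  S 0 -> (forall a b, S a -> S b -> S (a + b)) ->
  (forall i, P i -> mspan S (F i)) -> mspan S (\prod_(i <- r | P i) F i).
Proof.
move=> S0 SD H; apply: (big_ind (mspan S)) => //; last by move=> f g; exact: mspanM.
by rewrite -(rmorph1 io); exact: mspan_const.
Qed.

(** Congruences to constants can be multiplied. The typical [S], positive degree in one variable, is
    closed under addition but does not contain 0. *)
Lemma cmodM S c d f g : (forall a b, S a -> S b -> S (a + b)) ->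
  mspan S (f - io c) -> mspan S (g - io d) -> mspan S (f * g - io (c * d)).
Proof.
move=> SD Sf Sg.
have -> : f * g - io (c * d)
    = (f - io c) * (g - io d) + (io d * (f - io c) + io c * (g - io d)).
  by rewrite rmorphM /=; ring.
by apply: mspanD; [exact: mspanM Sf Sg|apply: mspanD; exact: mspanZ].
Qed.

Lemma cmod_prod S I (r : seq I) (P : pred I) (F : I -> Om) (c : I -> K) :
  (forall a b, S a -> S b -> S (a + b)) ->
  (forall i, P i -> mspan S (F i - io (c i))) ->
  mspan S (\prod_(i <- r | P i) F i - io (\prod_(i <- r | P i) c i)).
Proof.
move=> SD H; elim: r => [|i r IH]; first by rewrite !big_nil rmorph1 subrr; exact: mspan0.
rewrite !big_cons; case: ifP => // Pi; apply: cmodM => //; exact: H.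
Qed.

(** Lists may repeat an exponent, so independence concerns collected coefficients. *)
Definition lin_indep := forall l : seq (K * G),
  \sum_(x <- l) io x.1 * chi x.2 = 0 -> forall e, \sum_(x <- l | x.2 == e) x.1 = 0.

(** Independence is applied to [l] followed by the negatives of [c] at [e] and of the representation
    of the error, in which [e] does not occur. *)
Lemma mspan_coef (l : seq (K * G)) e c : lin_indep ->
  mspan (fun a => a <> e) (\sum_(x <- l) io x.1 * chi x.2 - io c * chi e) ->
  \sum_(x <- l | x.2 == e) x.1 = c.
Proof.
move=> ind [r rS /eqP]; rewrite subr_eq addrC => /eqP E.
have := ind (l ++ (- c, e) :: [seq (- x.1, x.2) | x <- r]).
rewrite big_cat big_cons big_map /= E rmorphN mulNr.
have -> : \sum_(x <- r) io (- x.1) * chi x.2 = - \sum_(x <- r) io x.1 * chi x.2.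
  by rewrite -sumrN; apply: eq_bigr => x _; rewrite rmorphN mulNr.
rewrite -opprD subrr => /(_ erefl e).
rewrite big_cat big_cons big_map /= eqxx [X in _ + (_ + X)]big1_seq.
  by rewrite addr0 => /eqP; rewrite subr_eq0 => /eqP.
by move=> x /andP [/eqP xe /rS] /=.
Qed.

End Span.

(** * Shifts and cancellations of q-Pochhammer symbols *)

Section QPoch.
Variables (F : fieldType) (q : F).
Implicit Types (x y w : F).

Lemma qpochS x n : qpoch x q n.+1 = qpoch x q n * (1 - q ^+ n * x).
Proof. by rewrite /qpoch big_ord_recr. Qed.

Lemma qpoch_shift w n : qpoch w q n * (1 - q ^+ n * w) = (1 - w) * qpoch (q * w) q n.
Proof.
rewrite -qpochS /qpoch big_ord_recl mul1r; congr (_ * _); apply: eq_bigr => i _.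
by rewrite lift0 exprSr mulrA.
Qed.

Lemma qpoch_nat x n : qpoch x q n = \prod_(0 <= d < n) (1 - q ^+ d * x).
Proof. by rewrite big_mkord. Qed.

Lemma qpoch_nat1 x n : qpoch (q * x) q n = \prod_(1 <= d < n.+1) (1 - q ^+ d * x).
Proof.
by rewrite big_add1 big_mkord /=; apply: eq_bigr => i _; rewrite exprSr mulrA.
Qed.

Lemma qpoch_inv_shift x n : x != 0 ->
  qpoch x^-1 q n * (q ^+ n - x) = qpoch (q * x^-1) q n * (1 - x).
Proof.
move=> x0; have := congr1 (fun u => u * - x) (qpoch_shift x^-1 n).
rewrite -!mulrA => E.
have -> : q ^+ n - x = (1 - q ^+ n / x) * - x by field.
rewrite E mulrC mulrAC -mulrA; congr (_ * _); field.
exact: x0.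
Qed.

(** Each induction step is [qpoch_inv_shift] at [q ^+ b.+1 * y], which lowers the power of [q] by
    one. *)
Lemma qpoch_inv_shift_iter y n b : q != 0 -> y != 0 ->
  qpoch (q ^+ b * y)^-1 q n * \prod_(1 <= d < b.+1) (q ^+ n - q ^+ d * y)
  = qpoch y^-1 q n * \prod_(1 <= d < b.+1) (1 - q ^+ d * y).
Proof.
move=> q0 y0; elim: b => [|b IH]; first by rewrite mul1r !big_nil.
rewrite ![\prod_(1 <= d < b.+2) _]big_nat_recr //= [RHS]mulrA -IH.
rewrite mulrCA qpoch_inv_shift; last by rewrite mulf_neq0 ?expf_neq0.
have -> : q * (q ^+ b.+1 * y)^-1 = (q ^+ b * y)^-1.
  by rewrite exprS; field; rewrite q0 y0 expf_neq0.
ring.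
Qed.

(* Cancelling the denominators [(q^-b z_j/z_i; q)_n] of a partial fraction
   against the q-Dyson factor of the pair leaves a polynomial in
   [y = z_i/z_j]. *)
Lemma qdyson_pair_lt y k n b : q != 0 -> y != 0 -> (b < k)%N ->
  qpoch y q k * qpoch (q * y^-1) q n
  = \prod_(0 <= d < b.+1) (q ^+ n - q ^+ d * y)
    * \prod_(b.+1 <= d < k) (1 - q ^+ d * y) * qpoch (q ^+ b * y)^-1 q n.
Proof.
move=> q0 y0 bk; rewrite qpoch_nat (big_cat_nat (n := b.+1)) //=.
rewrite [LHS]mulrC mulrA [RHS]mulrAC; congr (_ * _).
rewrite !(@big_ltn _ _ _ 0) //= !mul1r mulrA -qpoch_inv_shift //.
by rewrite -[RHS]mulrA [_ * qpoch _ _ _]mulrC qpoch_inv_shift_iter // mulrCA mulrA.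
Qed.

(** The pair in the opposite order. Here the factors in [y] start at [d = 1], so the iterated shift
    applies directly, without the additional step at [d = 0]. *)
Lemma qdyson_pair_gt y k n b : q != 0 -> y != 0 -> (b < k)%N ->
  qpoch y^-1 q n * qpoch (q * y) q k
  = \prod_(1 <= d < b.+1) (q ^+ n - q ^+ d * y)
    * \prod_(b.+1 <= d < k.+1) (1 - q ^+ d * y) * qpoch (q ^+ b * y)^-1 q n.
Proof.
move=> q0 y0 bk; rewrite qpoch_nat1 (big_cat_nat (n := b.+1)) //=; last exact: ltnW.
by rewrite mulrA [RHS]mulrAC; congr (_ * _); rewrite -qpoch_inv_shift_iter // mulrC.
Qed.

End QPoch.

(** * Removing one variable from the q-Dyson product *)

Section Expansion.
Variables (K Om : fieldType) (io : {rmorphism K -> Om}) (s : nat).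
Variables (z : 'I_s -> Om) (q : K) (beta : 'I_s -> nat) (N : nat).
Hypothesis z0 : forall i, z i != 0.
Hypothesis q0 : q != 0.
Hypothesis zfree : forall i j a b, io q ^+ a * z i = io q ^+ b * z j -> i = j /\ a = b.
Hypothesis beta0 : forall i, (0 < beta i)%N.

Local Notation Q := (io q).
Local Notation expo := {ffun 'I_s -> int}.

Definition chi (a : expo) : Om := \prod_i z i ^ a i.

Lemma chiD a b : chi (a + b) = chi a * chi b.
Proof.
rewrite -big_split; apply: eq_bigr => i _ /=.
by rewrite ffunE expfzDr.
Qed.

Lemma chi0 : chi 0 = 1.
Proof. by rewrite /chi big1 // => i _; rewrite ffunE expr0z. Qed.

Definition eps (i : 'I_s) : expo := [ffun k => (k == i)%:Z].

Lemma chi_eps i c : chi (eps i *+ c) = z i ^+ c.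
Proof.
rewrite /chi (bigD1 i) //= big1 ?mulr1.
  by rewrite ffunMnE ffunE eqxx [RHS]exprnP; congr (_ ^ _); exact: natz.
by move=> j /negPf ji; rewrite ffunMnE ffunE ji mul0rn expr0z.
Qed.

Lemma chiN a : chi (- a) = (chi a)^-1.
Proof.
have E : chi (- a) * chi a = 1 by rewrite -chiD addNr chi0.
have n0 : chi a != 0 by apply: contra_eq_neq E => ->; rewrite mulr0 eq_sym oner_neq0.
by rewrite -[LHS](mulfK n0) E mul1r.
Qed.

Local Notation zspan := (mspan io chi).

Lemma zspan_const S c : S 0 -> zspan S (io c).
Proof. exact: (mspan_const io chi0). Qed.

Lemma zspanX S i c : S (eps i *+ c) -> zspan S (z i ^+ c).
Proof.
by move=> H; rewrite -chi_eps -[chi _]mul1r -(rmorph1 io); apply: mspan_chi.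
Qed.

Lemma chi_ratio i j : chi (eps i - eps j) = z i / z j.
Proof. by rewrite chiD chiN -[eps i]mulr1n -[eps j]mulr1n !chi_eps. Qed.

Lemma Q0 : Q != 0. Proof. by rewrite fmorph_eq0. Qed.

(** The q-Dyson factor of an unordered pair: it is symmetric for [i != j], so all factors involving
    a chosen [z i] can be collected in one form. *)
Definition pfac (i j : 'I_s) : Om :=
  if (i < j)%N then qpoch (z i / z j) Q (beta i) * qpoch (Q * (z j / z i)) Q (beta j)
  else qpoch (z j / z i) Q (beta j) * qpoch (Q * (z i / z j)) Q (beta i).

Definition dyson (A : {set 'I_s}) : Om :=
  \prod_(i in A) \prod_(j in A | (i < j)%N) pfac i j.

(* Equal to the complete homogeneous function only for [m <= N]. *)
Definition hsym (A : {set 'I_s}) (m : nat) : Om :=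
  (\prod_(i in A) \prod_(b < beta i) geom N (Q ^+ b * z i))`_m.

(** Partners larger than [i] form the row of [i]; smaller partners are pulled out of their own rows.
    The symmetry of [pfac] merges the two products. *)
Lemma dysonD1 (A : {set 'I_s}) i : i \in A ->
  dyson A = dyson (A :\ i) * \prod_(j in A :\ i) pfac i j.
Proof.
move=> iA; rewrite /dyson (big_setD1 i) //=.
have -> : \prod_(k in A :\ i) \prod_(j in A | (k < j)%N) pfac k j
   = \prod_(k in A :\ i) ((if (k < i)%N then pfac k i else 1) *
       \prod_(j in A :\ i | (k < j)%N) pfac k j).
  apply: eq_bigr => k _; case: ifP => ki.
    rewrite (bigD1 i) /= ?iA //; congr (_ * _); apply: eq_bigl => j.
    by rewrite !inE andbC andbA.
  rewrite mul1r; apply: eq_bigl => j; rewrite !inE.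
  by case: eqVneq => // ->; rewrite ki andbF.
rewrite big_split /= mulrA [LHS]mulrC; congr (_ * _).
rewrite [RHS](bigID (fun j : 'I_s => (i < j)%N)) /=; congr (_ * _).
  apply: eq_bigl => j; rewrite !inE; case: eqVneq => // ->.
  by rewrite ltnn andbF.
rewrite -big_mkcondr /=; apply: eq_big => [j|j].
  rewrite !inE; case: eqVneq => //= ji; case: (j \in A) => //=.
  by rewrite -leqNgt ltn_neqAle ji.
by move=> /andP [_ ji]; rewrite /pfac ji ltnNge (ltnW ji).
Qed.

(** The quotient of [pfac i j] by the denominators that the letters of [z j] contribute at the
    letter [Q ^+ b * z i], as [pfac_qfac] shows; it is a polynomial in [z i / z j]. *)
Definition qfac (i j : 'I_s) (b : nat) : Om :=
  let y := z i / z j in let n := beta j in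
  if (i < j)%N then \prod_(0 <= d < b.+1) (Q ^+ n - Q ^+ d * y)
                    * \prod_(b.+1 <= d < beta i) (1 - Q ^+ d * y)
  else \prod_(1 <= d < b.+1) (Q ^+ n - Q ^+ d * y)
       * \prod_(b.+1 <= d < (beta i).+1) (1 - Q ^+ d * y).

Lemma pfac_qfac i j b : (b < beta i)%N ->
  pfac i j = qfac i j b * qpoch (z j / (Q ^+ b * z i)) Q (beta j).
Proof.
move=> bi; have y0 : z i / z j != 0 by rewrite mulf_neq0 ?invr_eq0.
have -> : z j / (Q ^+ b * z i) = (Q ^+ b * (z i / z j))^-1.
  by rewrite !invfM invrK; ring.
have yV : z j / z i = (z i / z j)^-1 by rewrite invfM invrK mulrC.
rewrite /pfac /qfac yV; case: ifP => _; first by apply: qdyson_pair_lt; rewrite ?Q0.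
by apply: qdyson_pair_gt; rewrite ?Q0.
Qed.

(** Partial-fraction weight of the letter [q ^+ b * z i] against the other letters of the same
    variable; [z i] cancels and a scalar remains. *)
Definition bcoef (n b : nat) : K := \prod_(c < n | c != b :> nat) (1 - q ^+ c / q ^+ b)^-1.

(** Partial fractions over all letters of [A], distinct by [zfree]. At a letter of [z i], the
    letters of the same variable give [bcoef], and those of each other variable combine into one
    q-Pochhammer symbol. *)
Lemma hsym_lagrange (A : {set 'I_s}) m : A != set0 -> (m <= N)%N ->
  hsym A m = \sum_(i in A) \sum_(b < beta i) (Q ^+ b * z i) ^+ m *
    (io (bcoef (beta i) b) *
      \prod_(j in A :\ i) (qpoch (z j / (Q ^+ b * z i)) Q (beta j))^-1).
Proof.
move=> A0 mN; pose l := [seq Q ^+ b * z i | i <- enum A, b <- index_iota 0 (beta i)].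
have big_l (R : Type) (idx : R) (op : Monoid.com_law idx) (F : Om -> R) :
   \big[op/idx]_(x <- l) F x
   = \big[op/idx]_(i in A) \big[op/idx]_(b < beta i) F (Q ^+ b * z i).
  rewrite big_allpairs_dep big_enum; apply: eq_bigr => i _ /=.
  by rewrite big_mkord.
have Ul : uniq l.
  apply: allpairs_uniq_dep; first exact: enum_uniq.
    by move=> i _; exact: iota_uniq.
  by move=> [i b] [j c] _ _ /= /zfree [-> ->].
have l0 : 0 \notin l.
  apply/negP => /allpairsPdep [i [b [_ _ /eqP]]].
  by rewrite eq_sym mulf_eq0 (negPf (z0 i)) expf_eq0 (negPf Q0) andbF.
have ln : l != [::].
  have [i iA] := set0Pn _ A0.
  have : Q ^+ 0 * z i \in l.
    apply/allpairsPdep; exists i, 0%N; split => //; first by rewrite mem_enum.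
    by rewrite mem_index_iota beta0.
  by apply: contraTneq => ->.
have -> : hsym A m = (\prod_(x <- l) geom N x)`_m by rewrite big_l.
rewrite coef_prod_geom_lagrange // big_l.
apply: eq_bigr => i iA; apply: eq_bigr => b _; congr (_ * _).
rewrite big_mkcond big_l (big_setD1 i) //=; congr (_ * _).
  rewrite -big_mkcond /= /bcoef rmorph_prod; apply: eq_big => [c|c _].
    apply/idP/idP; apply: contraNN => /eqP.
      by move=> ->.
    by move=> /zfree [_ ->].
  rewrite fmorphV rmorphB rmorph1 rmorphM fmorphV !rmorphXn.
  by rewrite invfM mulrACA divff ?mulr1.
apply: eq_bigr => j; rewrite !inE => /andP [ji _].
rewrite -big_mkcond /= (eq_bigl xpredT); last first.
  by move=> c; apply/eqP => /zfree [] /eqP; rewrite (negPf ji).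
rewrite prodfV; congr (_^-1).
by rewrite /qpoch; apply: eq_bigr => c _; rewrite mulrA.
Qed.

(** The recursion that removes one variable: by [pfac_qfac] the pair factors of [z i] cancel the
    denominators of [hsym_lagrange], leaving the polynomials [qfac]. *)
Lemma hsym_dyson (A : {set 'I_s}) m : A != set0 -> (m <= N)%N ->
  hsym A m * dyson A = \sum_(i in A) \sum_(b < beta i)
    io (q ^+ (b * m) * bcoef (beta i) b) * z i ^+ m *
      (\prod_(j in A :\ i) qfac i j b) * dyson (A :\ i).
Proof.
move=> A0 mN; rewrite hsym_lagrange // big_distrl; apply: eq_bigr => i iA /=.
rewrite big_distrl; apply: eq_bigr => b _ /=.
have -> : dyson A = dyson (A :\ i) * (\prod_(j in A :\ i) qfac i j b *
    \prod_(j in A :\ i) qpoch (z j / (Q ^+ b * z i)) Q (beta j)).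
  rewrite (dysonD1 iA); congr (_ * _); rewrite -big_split.
  by apply: eq_bigr => j _; exact: pfac_qfac.
rewrite rmorphM rmorphXn exprMn -exprM prodfV.
set P := \prod_(j in _) qpoch _ _ _.
have P0 : P != 0.
  apply/prodf_neq0 => j; rewrite !inE => /andP [ji _].
  apply/prodf_neq0 => c _; rewrite mulrA subr_eq0.
  apply: contraNN ji => /eqP /(congr1 (fun u => u * (Q ^+ b * z i))).
  rewrite mul1r divfK; last by rewrite mulf_neq0 ?expf_neq0 ?Q0.
  by move=> /zfree [/eqP]; rewrite eq_sym.
by field.
Qed.


(** * Supports of the expansions and dominance *)

Definition nonneg_off (A : {set 'I_s}) (a : expo) : Prop := forall j, j \notin A -> 0 <= a j.

Lemma nonneg_off0 A : nonneg_off A 0.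
Proof. by move=> j _; rewrite ffunE. Qed.

Lemma nonneg_offD A a b : nonneg_off A a -> nonneg_off A b -> nonneg_off A (a + b).
Proof. by move=> ha hb j jA; rewrite ffunE addr_ge0 ?ha ?hb. Qed.

Lemma zspan_qpoch (S : expo -> Prop) c a n : S 0 ->
  (forall a b, S a -> S b -> S (a + b)) -> S a -> zspan S (qpoch (io c * chi a) Q n).
Proof.
move=> S0 SD Sa; rewrite /qpoch; apply: (mspan_prod chiD chi0) => // d _.
rewrite -(rmorph1 io) mulrA -rmorphXn -rmorphM.
by apply: (mspanB chiD chi0); [exact: zspan_const|exact: mspan_chi].
Qed.

Lemma nonneg_off_ratio (A : {set 'I_s}) i j :
  i \in A -> j \in A -> nonneg_off A (eps i - eps j).
Proof.
move=> iA jA k kA; rewrite !ffunE.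
by rewrite ![k == _]eq_sym (negPf (memPn kA i iA)) (negPf (memPn kA j jA)).
Qed.

Lemma zspan_dyson A : zspan (nonneg_off A) (dyson A).
Proof.
have S0 := @nonneg_off0 A; have SD := @nonneg_offD A.
rewrite /dyson; apply: (mspan_prod chiD chi0) => // i iA.
apply: (mspan_prod chiD chi0) => // j /andP [jA ij]; rewrite /pfac ij.
rewrite -!chi_ratio -[X in qpoch X _ _]mul1r -(rmorph1 io).
by apply: (mspanM chiD SD); apply: zspan_qpoch => //; exact: nonneg_off_ratio.
Qed.

Lemma coef_prod_geom_scale (x : Om) n m :
  (\prod_(b < n) geom N (Q ^+ b * x))`_m
  = io (\prod_(b < n) geom N (q ^+ b))`_m * x ^+ m.
Proof.
elim: n m => [|n IH] m.
  by rewrite !big_ord0 !coef1; case: m => [|m]; rewrite ?rmorph1 ?rmorph0 ?mulr1 ?mul0r.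
rewrite !big_ord_recr /= !coefM rmorph_sum big_distrl; apply: eq_bigr => j _ /=.
rewrite IH !coef_poly rmorphM /=; case: ifP => _; last by rewrite rmorph0 !mulr0 mul0r.
have -> : x ^+ m = x ^+ j * x ^+ (m - j) by rewrite -exprD subnKC // -ltnS.
by rewrite exprMn !rmorphXn; ring.
Qed.

Definition gcoef n m : K := (\prod_(b < n) geom N (q ^+ b))`_m.

Lemma hsymD1 (A : {set 'I_s}) i m : i \in A ->
  hsym A m = hsym (A :\ i) m
    + \sum_(c < m) io (gcoef (beta i) c.+1) * z i ^+ c.+1 * hsym (A :\ i) (m - c.+1).
Proof.
move=> iA; rewrite /hsym (big_setD1 i) //= coefM big_ord_recl subn0.
rewrite coef_prod_geom_scale expr0 mulr1 coef0_prod big1 => [|b _]; last first.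
  by rewrite coef_poly.
rewrite rmorph1 mul1r; congr (_ + _); apply: eq_bigr => c _.
by rewrite lift0 coef_prod_geom_scale.
Qed.

Lemma zspan_hsym (A : {set 'I_s}) m (S : expo -> Prop) : S 0 ->
  (forall a b, S a -> S b -> S (a + b)) -> (forall i, i \in A -> S (eps i)) ->
  zspan S (hsym A m).
Proof.
move=> S0 SD Se; rewrite /hsym; elim/big_rec: _ m => [|i p iA IH] m.
  by rewrite coef1 -(rmorph_nat io); exact: zspan_const.
rewrite coefM; apply: mspan_sum => c _; apply: (mspanM chiD SD) (IH _).
rewrite coef_prod_geom_scale; apply: (mspanZ chiD chi0); apply: zspanX.
by elim: (nat_of_ord c) => [|k IHk]; rewrite ?mulr0n // mulrS; apply: SD => //; exact: Se.
Qed.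

(** Expanding every factor by [hsymD1] leaves one term free of [z i]. Each other term records a
    positive power of [z i] and the lowered degrees. Conservation of the total degree serves the
    dominance bound, positivity of the power the leading coefficient. *)
Lemma prod_hsymD1 (A : {set 'I_s}) i (ms : seq nat) : i \in A -> all (leq^~ N) ms ->
  exists2 l : seq (K * (nat * seq nat)),
    forall t, t \in l -> [/\ (0 < t.2.1)%N, size t.2.2 = size ms,
                            (t.2.1 + sumn t.2.2 = sumn ms)%N & all (leq^~ N) t.2.2]
  & \prod_(m <- ms) hsym A m = \prod_(m <- ms) hsym (A :\ i) m
     + \sum_(t <- l) io t.1 * z i ^+ t.2.1 * \prod_(m <- t.2.2) hsym (A :\ i) m.
Proof.
move=> iA; elim: ms => [|m ms IH]; first by exists [::]; rewrite ?big_nil ?addr0.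
move=> /= /andP [mN cN]; have [l lP lE] := IH cN.
pose hd := [seq (gcoef (beta i) c.+1, (c.+1, (m - c.+1)%N)) | c <- index_iota 0 m].
(* The power of [z i] comes from the tail only, from the head only, or from both. *)
exists ([seq (t.1, (t.2.1, m :: t.2.2)) | t <- l]
   ++ [seq (c.1, (c.2.1, c.2.2 :: ms)) | c <- hd]
   ++ [seq (c.1 * t.1, ((c.2.1 + t.2.1)%N, c.2.2 :: t.2.2)) | c <- hd, t <- l]).
  have hdP c : c \in hd -> [/\ (0 < c.2.1)%N, (c.2.1 + c.2.2 = m)%N & (c.2.2 <= N)%N].
    by move=> /mapP [k + ->] /=; rewrite mem_index_iota => km; split => //; lia.
  move=> t; rewrite !mem_cat => /or3P
    [/mapP [t' /lP [h1 h2 h3 h4] ->]|/mapP [c /hdP [h1 h2 h3] ->]|].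
  - by rewrite /= h2 h4 mN addnCA h3.
  - by rewrite /= h3 cN addnA h2.
  - move=> /allpairsP [[c t'] [/= /hdP [g1 g2 g3] /lP [h1 h2 h3 h4] ->]] /=.
    by rewrite h2 h4 g3 addnACA g2 h3 addn_gt0 g1.
have hE : hsym A m = hsym (A :\ i) m
    + \sum_(c <- hd) io c.1 * z i ^+ c.2.1 * hsym (A :\ i) c.2.2.
  by rewrite (hsymD1 _ iA) big_map big_mkord.
rewrite !big_cons lE hE !big_cat big_allpairs_dep ![\sum_(_ <- map _ _) _]big_map.
rewrite mulrDl mulrDr -addrA.
congr (_ + _); rewrite /=; congr (_ + _).
  rewrite big_distrr; apply: eq_bigr => t _ /=.
  by rewrite big_cons; ring.
rewrite mulrDr; congr (_ + _).
  rewrite big_distrl; apply: eq_bigr => c _ /=.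
  by rewrite big_cons; ring.
rewrite big_distrl; apply: eq_bigr => c _ /=.
rewrite big_distrr; apply: eq_bigr => t _ /=.
by rewrite big_cons exprD rmorphM; ring.
Qed.

Lemma zspan_lin (S : expo -> Prop) c d a : S 0 -> S a -> zspan S (io c - io d * chi a).
Proof.
by move=> S0 Sa; apply: (mspanB chiD chi0); [exact: zspan_const|exact: mspan_chi].
Qed.

Lemma sum_eps (I : {set 'I_s}) i : \sum_(j in I) eps i j = (i \in I)%:Z.
Proof.
case: (boolP (i \in I)) => iI.
  rewrite (big_setD1 i) //= ffunE eqxx big1 ?addr0 // => j.
  by rewrite !inE ffunE => /andP [/negPf ->].
by rewrite big1 // => j jI; rewrite ffunE (negPf (memPn iI j jI)).
Qed.

(** Ratios [z i / z j] move degree towards [z i], so no index set containing [i] gets negative total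
    degree; unlike the shape of the monomial, this is stable under addition of exponents. *)
Definition heavy (A : {set 'I_s}) i (a : expo) : Prop :=
  nonneg_off A a /\ forall I : {set 'I_s}, i \in I -> 0 <= \sum_(j in I) a j.

Lemma heavy0 A i : heavy A i 0.
Proof.
split; first exact: nonneg_off0.
by move=> I _; rewrite big1 // => j _; rewrite ffunE.
Qed.

Lemma sumffD (I : {set 'I_s}) (a b : expo) :
  \sum_(j in I) (a + b) j = \sum_(j in I) a j + \sum_(j in I) b j.
Proof. by rewrite -big_split; apply: eq_bigr => j _; rewrite ffunE. Qed.

Lemma heavyD A i a b : heavy A i a -> heavy A i b -> heavy A i (a + b).
Proof.
move=> [a1 a2] [b1 b2]; split; first exact: nonneg_offD.
by move=> I iI; rewrite sumffD addr_ge0 ?a2 ?b2.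
Qed.

Lemma heavy_ratio (A : {set 'I_s}) i j : i \in A -> j \in A -> heavy A i (eps i - eps j).
Proof.
move=> iA jA; split; first exact: nonneg_off_ratio.
move=> I iI; rewrite sumffD.
have -> : \sum_(k in I) (- eps j) k = - \sum_(k in I) eps j k.
  by rewrite -sumrN; apply: eq_bigr => k _; rewrite ffunE.
by rewrite !sum_eps iI; case: (j \in I).
Qed.

Lemma zspan_qfac (A : {set 'I_s}) i j b : i \in A -> j \in A ->
  zspan (heavy A i) (qfac i j b).
Proof.
move=> iA jA; have S0 := @heavy0 A i; have SD := @heavyD A i.
have lin c d : zspan (heavy A i) (io c - Q ^+ d * (z i / z j)).
  by rewrite -chi_ratio -rmorphXn; apply: zspan_lin => //; exact: heavy_ratio.
have lin1 d : zspan (heavy A i) (1 - Q ^+ d * (z i / z j)) by rewrite -(rmorph1 io).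
rewrite /qfac -[Q ^+ beta j]rmorphXn.
by case: ifP => _; apply: (mspanM chiD SD); apply: (mspan_prod chiD chi0).
Qed.

(** The [n] largest exponents over [A] have sum at least [v] when some [n] of them do, so no sorting
    is involved. The minimum covers [n] beyond the number of variables, where all of [A] is
    taken. *)
Definition dom_on (A : {set 'I_s}) (n v : nat) (a : expo) : Prop :=
  nonneg_off A a /\
  exists I : {set 'I_s}, [/\ I \subset A, #|I| = minn n #|A| & v%:Z <= \sum_(j in I) a j].

Lemma hsym_set0 m : hsym set0 m = (m == 0%N)%:R.
Proof. by rewrite /hsym big_set0 coef1. Qed.

Lemma zspan_hsym_nonneg_off (A : {set 'I_s}) m : zspan (nonneg_off A) (hsym A m).
Proof.
apply: zspan_hsym; [exact: nonneg_off0|exact: nonneg_offD|].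
by move=> i iA j jA; rewrite ffunE.
Qed.

Lemma zspan_prod_hsym_nonneg_off (A : {set 'I_s}) (ms : seq nat) :
  zspan (nonneg_off A) (\prod_(m <- ms) hsym A m).
Proof.
apply: (mspan_prod chiD chi0); [exact: nonneg_off0|exact: nonneg_offD|].
by move=> m _; exact: zspan_hsym_nonneg_off.
Qed.

(** Degree count for one removal: [e + m] is the power of [z i], [u] the sum of the other selected
    parts, [v] the part of it left after [e] was drawn from the expansions, and [w] the exponent of
    [z i] in the remaining factors. *)
Lemma dom_arith (m e u v : nat) (x y w : int) : (u <= e + v)%N ->
  v%:Z <= y -> 0 <= w -> 0 <= x - (e + m)%:Z -> (m + u)%:Z <= x + (w + y).
Proof. lia. Qed.

(** Induction on the number of selected parts [js]. By [hsym_dyson] the first part [m] removes a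
    variable [z i], which gains degree [m]. Degree that the other selected factors lose to [z i] is
    returned by its power, and what remains over [A :\ i] has no negative power of [z i]. *)
Lemma zspan_dominance (js rs : seq nat) (A : {set 'I_s}) :
  all (leq^~ N) js -> all (leq^~ N) rs ->
  zspan (dom_on A (size js) (sumn js))
    (dyson A * \prod_(m <- js) hsym A m * \prod_(m <- rs) hsym A m).
Proof.
move: {-1}(size js) (erefl (size js)) => n; elim: n js rs A => [|n IH] js rs A.
  move=> /size0nil -> _ _ /=; rewrite big_nil mulr1.
  apply: (@mspanW _ _ _ _ _ (nonneg_off A)).
    move=> a na; split=> //; exists set0; rewrite sub0set cards0 min0n; split=> //.
    by rewrite big_set0.
  apply: (mspanM chiD (@nonneg_offD A)); first exact: zspan_dyson.
  exact: zspan_prod_hsym_nonneg_off.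
case: js => // m js /= [sj] /andP [mN jN] rN.
(* With no variables left, [hsym set0] vanishes in positive degree, so only zero parts matter. *)
have [->|A0] := eqVneq A set0.
  have [m0|m0] := boolP (m + sumn js == 0)%N; last first.
    have -> : \prod_(k <- m :: js) hsym set0 k = 0.
      have : (sumn (m :: js) != 0)%N by [].
      elim: (m :: js) => [|k ks IHk] //=; rewrite big_cons hsym_set0.
      by case: k => [|k] /=; rewrite ?mul0r // add0n => /IHk ->; rewrite mulr0.
    by rewrite mulr0 mul0r; exact: mspan0.
  apply: (@mspanW _ _ _ _ _ (nonneg_off set0)).
    move=> a na; split=> //; exists set0; rewrite sub0set cards0 minn0; split=> //.
    by rewrite big_set0 (eqP m0).
  apply: (mspanM chiD (@nonneg_offD set0)); last exact: zspan_prod_hsym_nonneg_off.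
  apply: (mspanM chiD (@nonneg_offD set0)); last exact: zspan_prod_hsym_nonneg_off.
  exact: zspan_dyson.
rewrite big_cons mulrA [dyson A * _]mulrC hsym_dyson // -mulrA big_distrl.
apply: mspan_sum => i iA; rewrite big_distrl; apply: mspan_sum => b _ /=.
have [l lP ->] := prod_hsymD1 iA jN; have [r rP ->] := prod_hsymD1 iA rN.
pose X e js' rs' := z i ^+ m * (\prod_(j in A :\ i) qfac i j b) * z i ^+ e
  * (dyson (A :\ i) * \prod_(m <- js') hsym (A :\ i) m * \prod_(m <- rs') hsym (A :\ i) m).
have XP e js' rs' : size js' = size js -> (sumn js <= e + sumn js')%N ->
    all (leq^~ N) js' -> all (leq^~ N) rs' ->
    zspan (dom_on A n.+1 (m + sumn js)) (X e js' rs').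
  move=> sj' hs j'N r'N.
  apply: (@mspanM _ _ _ _ _ chiD
     (fun a => a i >= e%:Z + m%:Z /\ heavy A i (a - eps i *+ (e + m)))
     (dom_on (A :\ i) n (sumn js'))).
  - move=> a a' [ai [ha1 ha2]] [ha' [I [IA cI hI]]].
    have iI : i \notin I.
      by apply: contraTN IA => iI; apply/subsetPn; exists i => //; rewrite !inE eqxx.
    split.
      move=> j jA; have := ha1 j jA; rewrite !ffunE ffunMnE ffunE.
      have ji : j != i by apply: contraNneq jA => ->.
      rewrite (negPf ji) mul0rn subr0 => aj; rewrite addr_ge0 //; apply: ha'.
      by rewrite !inE negb_and jA orbT.
    (* The index set from the induction hypothesis is enlarged by the removed variable; heaviness
       bounds the first exponent on it. *)
    exists (i |: I); split.
    + by rewrite subUset sub1set iA (subset_trans IA) // subsetDl.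
    + by rewrite cardsU1 iI cI (cardsD1 i A) iA add1n minnSS.
    rewrite sumffD [X in _ + X]big_setU1 //=.
    have := ha2 (i |: I) (setU11 _ _); rewrite sumffD.
    have -> : \sum_(k in i |: I) (- (eps i *+ (e + m))) k = - (e + m)%:Z.
      rewrite (big_setU1 _ iI) /= ffunE ffunMnE ffunE eqxx big1 ?addr0 ?natz //.
      by move=> k kI; rewrite ffunE ffunMnE ffunE (negPf (memPn iI k kI)) mul0rn oppr0.
    have := ha' i; rewrite !inE eqxx /= => /(_ isT).
    exact: dom_arith hs hI.
  - rewrite -mulrA mulrC -mulrA -exprD.
    apply: (@mspanM _ _ _ _ _ chiD (heavy A i) (fun a => a = eps i *+ (e + m))).
    + move=> a _ [a1 a2] ->; split; last by rewrite addrK.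
      have := a2 [set i] (set11 i).
      rewrite big_set1 !ffunE ffunMnE ffunE eqxx natz.
      by rewrite -PoszD lerDr.
    + apply: (mspan_prod chiD chi0); [exact: heavy0|exact: heavyD|].
      by move=> j; rewrite !inE => /andP [_ jA]; exact: zspan_qfac.
    exact: zspanX.
  - by apply: IH => //; rewrite sj' sj.
have {}XP c e js' rs' Y : io c * X e js' rs' = Y ->
    size js' = size js -> (sumn js <= e + sumn js')%N ->
    all (leq^~ N) js' -> all (leq^~ N) rs' ->
    zspan (dom_on A n.+1 (m + sumn js)) Y.
  by move=> <- *; apply: (mspanZ chiD chi0); exact: XP.
(* Four kinds of terms, by whether [z i] is drawn from the [js] factors, the [rs] factors, both or
   neither; [e] is the total power drawn. *)
rewrite [X in mspan _ _ _ X]mulrA mulrDr; apply: mspanD.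
  rewrite mulrDr mulrDl; apply: mspanD.
    by apply: (XP (q ^+ (b * m) * bcoef (beta i) b) 0%N js rs) => //; rewrite /X expr0; ring.
  rewrite big_distrr big_distrl; apply: mspan_sum_seq => t /lP [t1 t2 t3 t4] _ /=.
  apply: (XP (q ^+ (b * m) * bcoef (beta i) b * t.1) t.2.1 t.2.2 rs) => //.
    by rewrite /X !rmorphM /=; ring.
  by rewrite t3.
rewrite big_distrr; apply: mspan_sum_seq => u /rP [u1 u2 u3 u4] _ /=.
rewrite mulrDr mulrDl; apply: mspanD.
  apply: (XP (q ^+ (b * m) * bcoef (beta i) b * u.1) u.2.1 js u.2.2) => //.
    by rewrite /X !rmorphM /=; ring.
  exact: leq_addl.
rewrite big_distrr big_distrl; apply: mspan_sum_seq => t /lP [t1 t2 t3 t4] _ /=.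
apply: (XP (q ^+ (b * m) * bcoef (beta i) b * t.1 * u.1) (t.2.1 + u.2.1)%N t.2.2 u.2.2) => //.
  by rewrite /X !rmorphM exprD /=; ring.
by rewrite -t3 addnAC leq_addr.
Qed.

Lemma q_inj (i : 'I_s) : injective (fun a => q ^+ a).
Proof.
move=> a c /= E.
by have [] : i = i /\ a = c by apply: zfree; rewrite -!rmorphXn E.
Qed.

Lemma q_not_root1 (i : 'I_s) k : q ^+ k.+1 != 1.
Proof. by apply/eqP => E; have := @q_inj i k.+1 0%N; rewrite /= expr0 => /(_ E). Qed.

(** Both sides are the complete homogeneous function of degree [M] in the letters 1, q, ...,
    q^(n-1): on the left by partial fractions, on the right by the q-binomial theorem. *)
Lemma sum_bcoef (i : 'I_s) n M : (0 < n)%N ->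
  \sum_(c < n) q ^+ (c * M) * bcoef n c = qpoch (q ^+ n) q M / qpoch q q M.
Proof.
move=> n0; rewrite -(@coef_prod_geom_qbinomial _ q M) //; last exact: q_not_root1.
pose l := [seq q ^+ c | c <- index_iota 0 n].
have big_l (R : Type) (idx : R) (op : Monoid.com_law idx) (F : K -> R) :
    \big[op/idx]_(x <- l) F x = \big[op/idx]_(c < n) F (q ^+ c).
  by rewrite big_map big_mkord.
rewrite -(big_l _ _ _ (geom M)) coef_prod_geom_lagrange //.
- rewrite big_l; apply: eq_bigr => c _; rewrite -exprM; congr (_ * _).
  rewrite big_mkcond big_l -big_mkcond; apply: eq_bigl => d /=.
  by rewrite (inj_eq (@q_inj i)).
- by rewrite map_inj_uniq ?iota_uniq //; exact: (@q_inj i).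
- by rewrite -size_eq0 size_map size_iota subn0 -lt0n.
by apply/mapP => [[c _ /eqP]]; rewrite eq_sym expf_eq0 (negPf q0) andbF.
Qed.

Lemma sorted_enum_ord (A : {set 'I_s}) : sorted (fun i j : 'I_s => i < j)%N (enum A).
Proof.
have -> : enum A = filter (mem A) (enum 'I_s) by rewrite enumT.
apply: sorted_filter; first by move=> ? ? ?; exact: ltn_trans.
by have := iota_ltn_sorted 0 s; rewrite -val_enum_ord sorted_map.
Qed.

(** * The leading coefficient when all [beta] are equal *)

Section Leading.
Variables (b : nat) (lam : 'I_s -> nat).
Hypothesis betab : forall i, beta i = b.
Hypothesis lam_dec : forall i j : 'I_s, (i <= j)%N -> (lam j <= lam i)%N.
Hypothesis lamN : forall i, (lam i <= N)%N.

(** The factor gained by removing a largest part [x] of multiplicity [m] among [n.+1] parts: a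
    q-binomial value times the geometric sum over the [m] positions of [x]. *)
Definition cstep (x n m : nat) : K :=
  qpoch (q ^+ b) q (x + n * b)%N / qpoch q q (x + n * b)%N
  * (q ^+ (b * (n.+1 - m))%N * (1 - q ^+ (b * m)%N) / (1 - q ^+ b)).

Fixpoint clist (l : seq nat) : K :=
  if l is x :: l' then cstep x (size l') (count_mem x l) * clist l' else 1.

(** Since [lam] decreases, the entries attaining [x] come first in [l]. Their numbers of successors
    are therefore consecutive, and the sum is geometric. *)
Lemma sum_top (l : seq 'I_s) x : sorted (fun i j : 'I_s => i < j)%N l ->
  {in l, forall i, lam i <= x}%N ->
  (1 - q ^+ b) * \sum_(i <- l | lam i == x) q ^+ (b * count (fun j : 'I_s => i < j)%N l)
  = q ^+ (b * (size l - count_mem x (map lam l))) * (1 - q ^+ (b * count_mem x (map lam l))).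
Proof.
elim: l => [|i l IH] /=; first by rewrite big_nil muln0 expr0 subrr !mulr0.
move=> il lx; have lx' : {in l, forall i, lam i <= x}%N.
  by move=> k kl; apply: lx; rewrite inE kl orbT.
have /allP imin : all (fun j : 'I_s => i < j)%N l.
  by apply: (order_path_min _ il) => ? ? ?; exact: ltn_trans.
have {IH} := IH (path_sorted il) lx'.
have cl := count_size (pred1 x) (map lam l); rewrite size_map in cl.
rewrite big_cons ltnn add0n.
have -> : \sum_(j <- l | lam j == x) q ^+ (b * ((j < i) + count (fun k : 'I_s => j < k) l))%N
        = \sum_(j <- l | lam j == x) q ^+ (b * count (fun k : 'I_s => j < k)%N l).
  rewrite big_seq_cond [RHS]big_seq_cond; apply: eq_bigr => j /andP [/imin ij _].
  by rewrite ltnNge (ltnW ij).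
have [lix E|lix _] /= := eqVneq (lam i) x.
  have -> : count (fun j : 'I_s => i < j)%N l = size l by apply/eqP; rewrite -all_count; apply/allP.
  rewrite mulrDr E add1n subSS mulnS mulnBr.
  have -> : q ^+ (b * size l)
      = q ^+ (b * size l - b * count_mem x (map lam l)) * q ^+ (b * count_mem x (map lam l)).
    by rewrite -exprD subnK // leq_mul2l cl orbT.
  by rewrite exprD; ring.
(* If the first entry is below [x], so are all later ones, and both sides vanish. *)
have lx0 : {in l, forall j, lam j != x}.
  move=> j jl; rewrite neq_ltn; apply/orP; left.
  apply: leq_ltn_trans (_ : lam i < x)%N; first by apply: lam_dec; exact: ltnW (imin _ jl).
  by rewrite ltn_neqAle lix lx ?mem_head.
have -> : count_mem x (map lam l) = 0%N.
  by apply/count_memPn/mapP => [[j /lx0 +] E]; rewrite E eqxx.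
rewrite big_seq_cond big1 ?muln0 ?expr0 ?subrr ?mulr0 //.
by move=> j /andP [/lx0 /negPf ->].
Qed.

(** The constant term of [qfac i j c] as a polynomial in [z i / z j], for equal [beta]: one factor
    [q ^+ b] for each shifted linear factor, of which there is one more when [i < j]. *)
Definition qfac0 (i j : 'I_s) (c : nat) : K := q ^+ (b * c) * (if (i < j)%N then q ^+ b else 1).

Lemma prod_qfac0 (A : {set 'I_s}) i c : i \in A ->
  \prod_(j in A :\ i) qfac0 i j c
  = q ^+ (c * (#|A|.-1 * b)) * q ^+ (b * count (fun j : 'I_s => i < j)%N (enum A)).
Proof.
move=> iA; rewrite big_split /= prodr_const -exprM (cardsD1 i A) iA add1n /=.
congr (_ * _); first by rewrite mulnAC mulnC [(b * _)%N]mulnC.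
have -> : \prod_(j in A :\ i) (if (i < j)%N then q ^+ b else 1)
    = \prod_(j in A) (if (i < j)%N then q ^+ b else 1).
  by rewrite [RHS](big_setD1 i) //= ltnn mul1r.
by rewrite -big_enum -big_mkcond /= big_const_seq -Monoid.iteropE exprM.
Qed.

(** By [prod_qfac0] the double sum factors: the sum over [c] is [sum_bcoef] in degree
    [x + #|A|.-1 * b], the sum over [i] is [sum_top]. *)
Lemma sum_leading (A : {set 'I_s}) (x : nat) i0 : i0 \in A ->
  {in A, forall i, lam i <= x}%N ->
  \sum_(i in A | lam i == x) \sum_(c < b) q ^+ (c * x) * bcoef b c
      * \prod_(j in A :\ i) qfac0 i j c
  = cstep x #|A|.-1 (count_mem x (map lam (enum A))).
Proof.
move=> i0A lx; have b0 : (0 < b)%N by rewrite -(betab i0).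
have b1 : 1 - q ^+ b != 0.
  by rewrite subr_eq0 eq_sym -(prednK b0); exact: q_not_root1.
have A0 : (0 < #|A|)%N by apply/card_gt0P; exists i0.
rewrite /cstep -(sum_bcoef i0) // prednK // cardE.
have <- := sum_top (sorted_enum_ord A) (_ : {in enum A, forall i, lam i <= x}%N); last first.
  by move=> i; rewrite mem_enum; exact: lx.
rewrite [(_ - _) * _ / _]mulrAC divff // mul1r big_enum_cond /= mulr_sumr.
apply: eq_bigr => i /andP [iA _]; rewrite big_distrl; apply: eq_bigr => c _ /=.
by rewrite prod_qfac0 // -cardE mulnDr exprD; ring.
Qed.

Definition lam_on (A : {set 'I_s}) : expo := [ffun i => if i \in A then (lam i)%:Z else 0].

Lemma lam_onD1 (A : {set 'I_s}) i : i \in A -> lam_on A = eps i *+ lam i + lam_on (A :\ i).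
Proof.
move=> iA; apply/ffunP => j; rewrite !ffunE ffunMnE ffunE !inE.
by case: eqVneq => [->|] /=; rewrite ?iA ?mul0rn ?add0r // natz addr0.
Qed.

(** Each factor is linear in [z i / z j], hence congruent to its constant term modulo positive
    powers of [z i]. *)
Lemma qfac_const (A : {set 'I_s}) i j c : j != i ->
  zspan (fun a => 0 < a i) (qfac i j c - io (qfac0 i j c)).
Proof.
move=> ji; set S := fun a : expo => _.
have SD a a' : S a -> S a' -> S (a + a') by rewrite /S ffunE => ? ?; exact: addr_gt0.
have Sr : S (eps i - eps j) by rewrite /S !ffunE eqxx eq_sym (negPf ji).
have lin (u : K) d : zspan S (io u - Q ^+ d * (z i / z j) - io u).
  rewrite addrC addKr; apply: (mspanN chiD chi0).
  by rewrite -chi_ratio -rmorphXn; exact: mspan_chi.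
have lin1 d : zspan S (1 - Q ^+ d * (z i / z j) - io 1).
  by have := lin 1 d; rewrite rmorph1.
rewrite /qfac /qfac0 betab -rmorphXn; case: ifP => ij.
  have -> : q ^+ (b * c) * q ^+ b
     = \prod_(0 <= d < c.+1) q ^+ b * \prod_(c.+1 <= d < beta i) 1.
    by rewrite big1_eq mulr1 prodr_const_nat subn0 -exprM mulnS addnC exprD.
  by apply: (cmodM chiD chi0) => //; apply: (cmod_prod chiD chi0).
have -> : q ^+ (b * c) * 1
     = \prod_(1 <= d < c.+1) q ^+ b * \prod_(c.+1 <= d < (beta i).+1) 1.
  by rewrite big1_eq !mulr1 prodr_const_nat subn1 -exprM.
by apply: (cmodM chiD chi0) => //; apply: (cmod_prod chiD chi0).
Qed.


(** Extract the largest part [x]. In the term of [z i] the exponent of [z i] is at least [x], so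
    indices with [lam i < x] miss [lam_on A]. For [lam i = x] any further power of [z i] misses it
    too, so constant terms remain, multiplied by the same expression over [A :\ i]. *)
Lemma zspan_leading (A : {set 'I_s}) :
  zspan (fun a => a <> lam_on A)
    (dyson A * \prod_(m <- map lam (enum A)) hsym A m
     - io (clist (map lam (enum A))) * chi (lam_on A)).
Proof.
move: {2}#|A| (erefl #|A|) => n; elim: n A => [|n IH] A cA.
  have -> : A = set0 by apply/eqP; rewrite -cards_eq0 cA.
  rewrite enum_set0 big_nil /= mulr1 /dyson big_set0 rmorph1 mul1r.
  have -> : lam_on set0 = 0 by apply/ffunP => j; rewrite !ffunE inE.
  by rewrite chi0 subrr; exact: mspan0.
have so := sorted_enum_ord A.
case E : (enum A) so => [|i0 t] so; first by move: cA; rewrite cardE E.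
have i0A : i0 \in A by rewrite -mem_enum E mem_head.
pose x := lam i0.
have lx : {in A, forall i, lam i <= x}%N.
  move=> i; rewrite -mem_enum E inE => /predU1P [-> //|it].
  apply: lam_dec; apply: ltnW.
  have /allP := order_path_min (leT := fun i j : 'I_s => (i < j)%N)
    (fun _ _ _ => @ltn_trans _ _ _) so.
  by apply.
have geq_trans : transitive geq by move=> a c d ca db; exact: leq_trans db ca.
have sA (B : {set 'I_s}) : sorted geq (map lam (enum B)).
  rewrite sorted_map; apply: sub_sorted (sorted_enum_ord B) => i j ij.
  by apply: lam_dec; exact: ltnW.
(* Equal parts are interchangeable: whichever index with part [x] is removed, the sorted list of
   remaining parts is the same. *)
have tl i : i \in A -> lam i = x -> map lam (enum (A :\ i)) = map lam t.
  move=> iA lix; apply: (sorted_eq geq_trans) => //.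
  - by move=> a c /andP [ca ac]; apply/eqP; rewrite eqn_leq; apply/andP.
  - by have := sA A; rewrite E /= => /path_sorted.
  rewrite -(perm_cons x) -{1}lix -map_cons -[x :: map _ _]/(map lam (i0 :: t)) -E.
  apply: perm_map; rewrite uniq_perm ?enum_uniq //=.
    by rewrite enum_uniq mem_enum !inE eqxx.
  move=> j; rewrite inE !mem_enum !inE.
  by case: eqVneq => // ->.
have -> : clist (map lam (i0 :: t)) = \sum_(i in A | lam i == x) \sum_(c < b)
    q ^+ (c * x) * bcoef b c * \prod_(j in A :\ i) qfac0 i j c * clist (map lam t).
  rewrite /= -/x size_map; have -> : size t = #|A|.-1 by rewrite cardE E.
  rewrite -[((x == x) + _)%N]/(count_mem x (map lam (i0 :: t))) -E.
  rewrite -(sum_leading i0A lx) big_distrl; apply: eq_bigr => i _ /=.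
  by rewrite big_distrl.
rewrite [map lam _]/= big_cons mulrA [dyson A * _]mulrC hsym_dyson //; last first.
  by apply/set0Pn; exists i0.
rewrite rmorph_sum !big_distrl /= [X in _ - X]big_mkcondr -sumrB.
apply: mspan_sum => i iA; rewrite betab -/x.
have posD (a a' : expo) : 0 < a i -> 0 <= a' i -> 0 < (a + a') i.
  by rewrite ffunE => ? ?; exact: ltr_pwDl.
have Dnn : zspan (fun a => 0 <= a i) (dyson (A :\ i)).
  by apply: (mspanW _ (zspan_dyson _)) => a; apply; rewrite !inE eqxx.
have hnn B : zspan (fun a => 0 <= a i) (\prod_(m <- map lam t) hsym B m).
  have S0 : 0 <= (0 : expo) i by rewrite ffunE.
  have SD (a a' : expo) : 0 <= a i -> 0 <= a' i -> 0 <= (a + a') i.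
    by rewrite ffunE; exact: addr_ge0.
  apply: (mspan_prod chiD chi0) => // m _; apply: zspan_hsym => // j _.
  by rewrite ffunE.
have [lix|lix] := eqVneq (lam i) x; last first.
  rewrite subr0 big_distrl; apply: mspan_sum => c _ /=.
  rewrite -!mulrA; apply: (mspanZ chiD chi0); rewrite !mulrA.
  have qnn : zspan (fun a => 0 <= a i) (\prod_(j in A :\ i) qfac i j c).
    apply: (@mspanW _ _ _ _ _ (heavy A i)).
      by move=> a [_ /(_ [set i] (set11 i))]; rewrite big_set1.
    apply: (mspan_prod chiD chi0); [exact: heavy0|exact: heavyD|].
    by move=> j; rewrite !inE => /andP [_ jA]; exact: zspan_qfac.
  have SD (a a' : expo) : x%:Z <= a i -> 0 <= a' i -> x%:Z <= (a + a') i.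
    by rewrite ffunE => h h'; rewrite -[x%:Z]addr0 lerD.
  apply: (@mspanW _ _ io _ chi (fun a => x%:Z <= a i)).
    move=> a xa aE; move: xa; rewrite aE ffunE iA lez_nat leqNgt.
    by rewrite ltn_neqAle lix lx.
  do 3! [apply: (mspanM chiD SD) => //].
  by apply: zspanX; rewrite ffunMnE ffunE eqxx natz.
rewrite rmorph_sum !big_distrl -sumrB; apply: mspan_sum => c _ /=.
have tN : all (leq^~ N) (map lam t) by apply/allP => _ /mapP [j _ ->]; exact: lamN.
have [l lP lE] := prod_hsymD1 iA tN.
pose P' := \prod_(j in A :\ i) qfac i j c - io (\prod_(j in A :\ i) qfac0 i j c).
pose R := \sum_(t <- l) io t.1 * z i ^+ t.2.1 * \prod_(m <- t.2.2) hsym (A :\ i) m.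
pose X' := dyson (A :\ i) * \prod_(m <- map lam t) hsym (A :\ i) m
   - io (clist (map lam t)) * chi (lam_on (A :\ i)).
(* The difference splits into terms with a surplus power of [z i], coming from [P'] or [R], and the
   term [X'] covered by the induction hypothesis. *)
have -> : io (q ^+ (c * x) * bcoef b c) * z i ^+ x * (\prod_(j in A :\ i) qfac i j c)
     * dyson (A :\ i) * \prod_(m <- map lam t) hsym A m
     - io (q ^+ (c * x) * bcoef b c * \prod_(j in A :\ i) qfac0 i j c * clist (map lam t))
       * chi (lam_on A)
   = io (q ^+ (c * x) * bcoef b c) * (z i ^+ x *
       (P' * (dyson (A :\ i) * \prod_(m <- map lam t) hsym A m)
        + io (\prod_(j in A :\ i) qfac0 i j c) * (dyson (A :\ i) * R)))
     + io (q ^+ (c * x) * bcoef b c * \prod_(j in A :\ i) qfac0 i j c) * (z i ^+ x * X').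
  rewrite (lam_onD1 iA) chiD chi_eps lix lE -/R /P' /X' !rmorphM; ring.
have xpos (f : Om) : zspan (fun a => 0 < a i) f ->
    zspan (fun a => a <> lam_on A) (z i ^+ x * f).
  move=> hf; apply: (@mspanM _ _ _ _ _ chiD (fun a => a i = x%:Z) (fun a => 0 < a i)) hf.
    move=> a a' ax a'0 /(congr1 (fun f : expo => f i)).
    rewrite !ffunE iA ax lix => /eqP; rewrite -[X in _ == X]addr0 (inj_eq (addrI _)).
    by rewrite gt_eqF.
  by apply: zspanX; rewrite ffunMnE ffunE eqxx natz.
apply: mspanD; apply: (mspanZ chiD chi0).
  apply: xpos; apply: mspanD.
    apply: (mspanM chiD posD); last first.
      by apply: (mspanM chiD _ Dnn (hnn A)) => a a'; rewrite ffunE; exact: addr_ge0.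
    apply: (cmod_prod chiD chi0).
      by move=> a a' ? a'0; apply: posD => //; exact: ltW.
    by move=> j; rewrite !inE => /andP [ji _]; exact: qfac_const.
  apply: (mspanZ chiD chi0); rewrite mulrC; apply: (mspanM chiD posD) Dnn.
  apply: mspan_sum_seq => u /lP [u1 _ _ _] _; rewrite -mulrA; apply: (mspanZ chiD chi0).
  apply: (mspanM chiD posD); first by apply: zspanX; rewrite ffunMnE ffunE eqxx natz.
  apply: (mspan_prod chiD chi0); rewrite ?ffunE //.
    by move=> a a'; rewrite ffunE; exact: addr_ge0.
  move=> m _; apply: zspan_hsym; rewrite ?ffunE //.
    by move=> a a'; rewrite ffunE; exact: addr_ge0.
  by move=> j; rewrite ffunE.
apply: (@mspanM _ _ _ _ _ chiD (fun a => a = eps i *+ x) (fun a => a <> lam_on (A :\ i))).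
- by move=> _ a -> ha; rewrite (lam_onD1 iA) lix => /addrI.
- exact: zspanX.
rewrite /X' -(tl i iA lix); apply: IH.
by move: cA; rewrite (cardsD1 i A) iA => - [].
Qed.

End Leading.
End Expansion.

(** * The closed form and the coefficient of the formal series *)

(** Induction on the list. Adding [x] to n parts, c of them equal to [x], raises half of n^2 minus
    the sum of squared multiplicities by n - c, and multiplies the multiplicity factor of [x] by (1
    - q^(b(c+1))) / (1 - q^b). These are the factors in [cstep]. *)
Lemma clistE (K : fieldType) (q : K) (b L : nat) (l : seq nat) : 1 - q ^+ b != 0 ->
  all (fun x => 0 < x <= L)%N l ->
  clist q b l =
   q ^+ ((b * (size l ^ 2 - \sum_(1 <= i < L.+1) (count_mem i l) ^ 2)) %/ 2)%N
   * (\prod_(1 <= i < L.+1)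
       (qpoch (q ^+ b) (q ^+ b) (count_mem i l) / (1 - q ^+ b) ^+ (count_mem i l)))
   * (\prod_(i < size l)
       (qpoch (q ^+ b) q (nth 0 l i + (size l - 1 - i) * b)%N
        / qpoch q q (nth 0 l i + (size l - 1 - i) * b)%N)).
Proof.
move=> b1 lL.
(* A witness [e] for the exponent replaces the truncated subtraction and the division by 2. *)
suff [e eE ->] : exists2 e, (size l ^ 2 = \sum_(1 <= i < L.+1) (count_mem i l) ^ 2 + 2 * e)%N &
  clist q b l = q ^+ (b * e)
   * (\prod_(1 <= i < L.+1)
       (qpoch (q ^+ b) (q ^+ b) (count_mem i l) / (1 - q ^+ b) ^+ (count_mem i l)))
   * (\prod_(i < size l)
       (qpoch (q ^+ b) q (nth 0 l i + (size l - 1 - i) * b)%N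
        / qpoch q q (nth 0 l i + (size l - 1 - i) * b)%N)).
  by rewrite eE addKn mulnCA mulKn.
elim: l lL => [|x l IH] /=.
  exists 0%N; first by rewrite big1.
  rewrite muln0 expr0 big1 ?big_ord0 ?mulr1 // => i _.
  by rewrite /qpoch big_ord0 divr1.
move=> /andP [xL /IH [e eE ->]].
have xI : x \in index_iota 1 L.+1 by rewrite mem_index_iota.
have UI : uniq (index_iota 1 L.+1) by exact: iota_uniq.
have cx i : i != x -> ((x == i) + count_mem i l = count_mem i l)%N.
  by rewrite eq_sym => /negPf ->.
have cl := count_size (pred1 x) l.
exists (e + (size l - count_mem x l))%N.
  move: eE; rewrite !(bigD1_seq x xI UI) /= eqxx.
  rewrite [X in _ -> _ = (_ + X + _)%N](eq_bigr (fun i => count_mem i l ^ 2)%N);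
    last by move=> i /cx ->.
  move: cl; set c := count_mem x l; set n := size l; set S := (\sum_(_ <- _ | _) _)%N.
  rewrite -!mulnn; nia.
rewrite /cstep eqxx add1n subSS [in RHS](bigD1_seq x xI UI) /= eqxx add1n.
rewrite [X in _ = _ * (_ * X) * _](eq_bigr (fun i => qpoch (q ^+ b) (q ^+ b) (count_mem i l)
   / (1 - q ^+ b) ^+ count_mem i l)); last by move=> i /cx ->.
rewrite [X in _ * (_ * X * _)](bigD1_seq x xI UI) /=.
rewrite big_ord_recl /= subSS subn0 subn0 !mulnDr exprD !qpochS !exprS.
rewrite [X in _ = _ * (_ * X)](eq_bigr (fun i : 'I_(size l) =>
   qpoch (q ^+ b) q (nth 0 l i + (size l - 1 - i) * b)%N
        / qpoch q q (nth 0 l i + (size l - 1 - i) * b)%N)); last first.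
  by move=> i _; rewrite /bump /= add1n subnS -subn1 subnAC.
set c := count_mem x l.
by rewrite [q ^+ (b * c.+1)]exprM exprSr !invfM; ring.
Qed.

(** * Sums of largest entries *)

Section TopSums.
Local Notation ger := (fun x y : int => y <= x).

Lemma sum_nth_take (a : seq int) n : \sum_(l < n) nth 0 a l = \sum_(x <- take n a) x.
Proof.
elim: n a => [|n IH] a; first by rewrite big_ord0 take0 big_nil.
case: a => [|x a]; first by rewrite big_nil big1 // => i _; rewrite nth_nil.
by rewrite big_ord_recl big_cons IH.
Qed.

(** Induction on the sorted list. If its head [h] lies in [x], it is removed from both sides;
    otherwise [h] bounds the first entry of [x], which takes the place of [h] in the complement
    [y]. *)
Lemma top_sum (a x y : seq int) : sorted ger a -> perm_eq (x ++ y) a ->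
  \sum_(u <- x) u <= \sum_(u <- take (size x) a) u.
Proof.
elim: a x y => [|h a IH] x y sa xy.
  by move: (perm_size xy); rewrite size_cat; case: x {xy} => // _; rewrite big_nil.
have /allP hmax : all (fun u => u <= h) a.
  by apply: (order_path_min _ sa) => u v w vu wv; exact: le_trans wv vu.
have {}sa := path_sorted sa.
case: x xy => [|x0 x] xy; first by rewrite take0 !big_nil.
rewrite /= big_cons.
have [hx|hx] := boolP (h \in x0 :: x).
  have px := perm_to_rem hx.
  have := perm_big _ px : \sum_(u <- x0 :: x) u = \sum_(u <- h :: rem h (x0 :: x)) u.
  rewrite !big_cons => ->; rewrite lerD2l.
  have -> : size x = size (rem h (x0 :: x)) by rewrite size_rem.
  apply: (IH _ y) => //; rewrite -(perm_cons h) -cat_cons; apply: perm_trans xy.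
  by rewrite perm_cat2r perm_sym.
have hy : h \in y.
  by have := perm_mem xy h; rewrite mem_cat (negPf hx) mem_head.
rewrite big_cons lerD //.
  have := perm_mem xy x0; rewrite mem_cat !inE eqxx /=.
  by move/esym => /orP [/eqP -> //|/hmax].
apply: (IH _ (x0 :: rem h y)) => //; rewrite -(perm_cons h).
apply: perm_trans xy; apply/permP => P.
have /permP/(_ P) /= yP := perm_to_rem hy.
by rewrite /= !count_cat /= yP; lia.
Qed.

End TopSums.

Lemma big_iota0 (R : Type) (idx : R) (op : R -> R -> R) n (F : nat -> R) :
  \big[op/idx]_(i <- iota 0 n) F i = \big[op/idx]_(i < n) F i.
Proof. by rewrite -(big_mkord xpredT) /index_iota subn0. Qed.

(** * Evaluation of formal Laurent polynomials in a field *)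

Section Linking.
Variables (K Om : fieldType) (jo : {rmorphism {poly int} -> K}) (io : {rmorphism K -> Om}).
Variables (s t : nat) (z : 'I_s -> Om) (w : 'I_t -> Om) (beta : 'I_s -> nat) (N : nat).
Hypothesis z0 : forall i, z i != 0.
Hypothesis w0 : forall j, w j != 0.
Local Notation q := (jo 'X).
Local Notation Q := (io q).
Hypothesis jo_inj : injective jo.
Let G : zmodType := ({ffun 'I_s -> int} * {ffun 'I_t -> int})%type.
Definition chij (x : mon s t) : Om := chi z x.1 * chi w x.2.
Hypothesis indep : lin_indep io (chij : G -> Om).

Lemma monME (a b : mon s t) : monM a b = (a : G) + b.
Proof. by rewrite /monM /=; congr (_, _); apply/ffunP => i; rewrite !ffunE. Qed.

Lemma chijD (a b : G) : chij (a + b) = chij a * chij b.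
Proof. by rewrite /chij /= !chiD // mulrACA. Qed.

Lemma chij0 : chij (0 : G) = 1.
Proof. by rewrite /chij /= !chi0 mulr1. Qed.

Lemma chijM (a b : mon s t) : chij (monM a b) = chij a * chij b.
Proof. by rewrite monME chijD. Qed.

Lemma chij_mon0 : chij (mon0 s t) = 1.
Proof.
rewrite -chij0 /mon0; congr chij; congr (_, _); apply/ffunP => i; by rewrite !ffunE.
Qed.

Lemma chijX n (a : mon s t) : chij (monX n a) = chij a ^+ n.
Proof.
have -> : monX n a = (a : G) *+ n.
  elim: n => [|n IH]; first by [].
  rewrite mulrS -IH /monX; congr (_, _); apply/ffunP => i; by rewrite !ffunE mulrS.
elim: n => [|n IH]; first exact: chij0.
by rewrite mulrS chijD IH exprS.
Qed.

Lemma chi_single n (v : 'I_n -> Om) (i : 'I_n) (c : int) (a : {ffun 'I_n -> int}) :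
  (forall k, a k = if k == i then c else 0) -> chi v a = v i ^ c.
Proof.
move=> ha; rewrite /chi (bigD1 i) //= ha eqxx big1 ?mulr1 // => k /negPf ki.
by rewrite ha ki expr0z.
Qed.

Lemma chi_mon0 n (v : 'I_n -> Om) : chi v [ffun=> 0] = 1.
Proof. by rewrite /chi big1 // => i _; rewrite ffunE expr0z. Qed.

Lemma chij_zz i j : chij (zz t i j) = z i / z j.
Proof.
rewrite /chij /= chi_mon0 mulr1 -chi_ratio //; congr chi.
by apply/ffunP => k; rewrite !ffunE.
Qed.

Lemma chij_zw i j : chij (zw i j) = z i / w j.
Proof.
rewrite /chij /= (@chi_single _ z i 1) ?expr1z.
  rewrite (@chi_single _ w j (-1)) // => k; rewrite ffunE.
  by case: eqP => //= _; rewrite oppr0.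
by move=> k; rewrite ffunE; case: eqP.
Qed.

Lemma q_free : injective (fun a => q ^+ a).
Proof.
move=> a b; rewrite -!rmorphXn => /jo_inj /(congr1 (fun p : {poly int} => size p)).
by rewrite !size_polyXn => - [].
Qed.

Lemma q_neq0 : q != 0.
Proof.
by rewrite -(rmorph0 jo) (inj_eq jo_inj) polyX_eq0.
Qed.

(** Independence applied to the relation with the two terms [q ^+ a] at z_i and [- q ^+ b] at
    z_j. *)
Lemma z_free i j a b : Q ^+ a * z i = Q ^+ b * z j -> i = j /\ a = b.
Proof.
move=> E; pose e k : G := (eps k, 0).
have ce k : chij (e k) = z k.
  by rewrite /chij /= chi0 mulr1 -[eps k]mulr1n chi_eps expr1.
have := indep (l := [:: (q ^+ a, e i); (- q ^+ b, e j)]).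
rewrite !big_cons big_nil addr0 /= !ce rmorphN mulNr !rmorphXn E subrr.
move=> /(_ erefl (e i)); rewrite !big_cons big_nil /= eqxx addr0.
have [ji|ji] := eqVneq (e j) (e i).
  have eji : j = i.
    have := congr1 (fun x : G => x.1 i) ji; rewrite /= !ffunE eqxx.
    by case: eqP => // ->.
  by move/eqP; rewrite subr_eq0 => /eqP /q_free ->.
by rewrite addr0 => /eqP; rewrite expf_eq0 (negPf q_neq0) andbF.
Qed.

Definition ev (p : lpoly s t) : Om := \sum_(x <- p) io (jo x.1) * chij x.2.

Lemma ev_lp1 : ev (lp1 s t) = 1.
Proof. by rewrite /ev big_seq1 /= !rmorph1 chij_mon0 mulr1. Qed.

Lemma ev_lpM p r : ev (lpM p r) = ev p * ev r.
Proof.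
rewrite /ev /lpM big_allpairs_dep big_distrl; apply: eq_bigr => x _ /=.
rewrite big_distrr; apply: eq_bigr => y _ /=.
by rewrite chijM !rmorphM mulrACA.
Qed.

Lemma ev_lpprod (ps : seq (lpoly s t)) : ev (lpprod ps) = \prod_(p <- ps) ev p.
Proof.
elim: ps => [|p ps IH]; first by rewrite big_nil -ev_lp1.
by rewrite big_cons -IH -ev_lpM.
Qed.

Lemma ev_lp_poch c x n : ev (lp_poch c x n) = qpoch (io (jo c) * chij x) Q n.
Proof.
rewrite ev_lpprod big_map big_iota0.
apply: eq_bigr => b _; rewrite /ev !big_cons big_nil addr0 /= chij_mon0 !rmorph1 mulr1.
by rewrite !rmorphN !rmorphM !rmorphXn mulNr -mulrA.
Qed.

Lemma ev_lp_ipoch i j n : ev (lp_ipoch (zw i j) n N)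
  = \prod_(b < n) (geom N (Q ^+ b * z i)).[(w j)^-1].
Proof.
rewrite ev_lpprod big_map big_iota0; apply: eq_bigr => b _.
rewrite /ev big_map big_iota0 horner_poly; apply: eq_bigr => m _ /=.
by rewrite chijX chij_zw !rmorphXn exprM -!exprMn mulrA.
Qed.

(** Exchanging the products over [i] and [j] collects, for each [w j], the polynomial with
    coefficients [hsym], evaluated at the inverse of [w j]. *)
Lemma ev_F_trunc : ev (F_trunc beta t N) = dyson io z q beta setT
  * \prod_(j < t) (\prod_(i in [set: 'I_s]) \prod_(b < beta i) geom N (Q ^+ b * z i)).[(w j)^-1].
Proof.
rewrite /F_trunc ev_lpprod big_cat !big_flatten !big_map /=; congr (_ * _).
  rewrite /dyson -enumT big_enum; apply: eq_big => [i|i _]; first by rewrite in_setT.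
  rewrite big_map big_filter_cond big_enum_cond; apply: eq_big => [j|j /andP [_ /andP [ij _]]].
    by rewrite in_setT andbT.
  by rewrite ev_lpM !ev_lp_poch !chij_zz !rmorph1 mul1r /pfac ij.
rewrite -enumT big_enum /=; under eq_bigr do rewrite big_map big_enum /=.
rewrite exchange_big; apply: eq_bigr => j _ /=; rewrite horner_prod.
apply: eq_big => [i|i _]; first by rewrite in_setT.
by rewrite horner_prod ev_lp_ipoch.
Qed.

Local Notation zdyson := (dyson io z q beta setT).
Local Notation zhsym := (hsym io z q beta N setT).

Lemma mspan_joint (S : {ffun 'I_s -> int} -> Prop) f (v : {ffun 'I_t -> int}) :
  mspan io (chi z) S f ->
  mspan io (chij : G -> Om) (fun a => S a.1 /\ a.2 = v) (f * chi w v).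
Proof.
move=> [l lS ->]; rewrite big_distrl; apply: mspan_sum_seq => x xl _ /=.
by rewrite -mulrA; apply: (@mspan_chi _ _ io G chij _ x.1 (x.2, v)); split=> //=; exact: lS.
Qed.

(** Reduces a coefficient of [F] to the coefficient of z^k in the q-Dyson product times the [hsym]
    of the degrees [m j]; [N] is exactly the truncation order in [Fcoef]. *)
Lemma Fcoef_mspan (k : {ffun 'I_s -> int}) (m : 'I_t -> nat) c :
  N = (\sum_(j < t) m j)%N ->
  mspan io (chi z) (fun a => a <> k) (zdyson * \prod_j zhsym (m j) - io c * chi z k) ->
  jo (Fcoef beta (k, [ffun j => - (m j)%:Z])) = c.
Proof.
move=> NE hk; rewrite /Fcoef /=.
have -> : (\sum_(j < t) `|[ffun j => - (m j)%:Z] j|)%N = N.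
  by rewrite NE; apply: eq_bigr => j _; rewrite ffunE abszN.
set e : G := (k, _).
rewrite /lpcoef rmorph_sum /=.
rewrite -(big_map (fun x => (jo x.1, x.2)) (fun x : K * mon s t => x.2 == e) (fun x => x.1)).
apply: (mspan_coef indep); rewrite big_map -/(ev _) ev_F_trunc.
set p := \prod_(i in _) _.
(* Large enough to list all coefficients of [p] and to contain every index [m j]. *)
pose M := (size p + N.+1)%N.
have hp v : p.[v] = \sum_(d < M) zhsym d * v ^+ d.
  by rewrite (@horner_coef_wide _ M) // leq_addr.
under eq_bigr do rewrite hp; rewrite bigA_distr_bigA /=.
have mN j : (m j <= N)%N by rewrite NE (bigD1 j) //= leq_addr.
have mM j : (m j < M)%N by rewrite /M; apply: leq_trans (leq_addl _ _); rewrite ltnS.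
pose f0 : {ffun 'I_t -> 'I_M} := [ffun j => Ordinal (mM j)].
have term (f : {ffun 'I_t -> 'I_M}) :
    \prod_j (zhsym (f j) * (w j)^-1 ^+ f j)
    = (\prod_j zhsym (f j)) * chi w [ffun j => - (f j)%:Z].
  rewrite big_split /=; congr (_ * _); apply: eq_bigr => j _.
  by rewrite ffunE exprVn exprnN.
(* Only the choice [f0] of degrees produces the w-exponent of [e]. *)
rewrite (bigD1 f0) //= mulrDr addrAC; apply: mspanD.
  rewrite term mulrA.
  have -> : [ffun j => - (f0 j : nat)%:Z] = [ffun j => - (m j)%:Z].
    by apply/ffunP => j; rewrite !ffunE.
  under eq_bigr do rewrite ffunE /=.
  rewrite /chij /= [io c * _]mulrA -mulrBl.
  apply: mspanW (mspan_joint _ hk) => a [ak _] ae; apply: ak.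
  by rewrite ae.
rewrite big_distrr /=; apply: mspan_sum => f ff0; rewrite term mulrA.
apply: (mspanW _ (@mspan_joint (fun _ => True) _ _ _)).
  move=> a [_ av] ae; move: av; rewrite ae /= => /ffunP fm; case/eqP: ff0.
  apply/ffunP => j; apply: val_inj; have := fm j; rewrite !ffunE /=.
  by move/oppr_inj => [].
apply: (mspanW (S := nonneg_off setT)) => //.
apply: (mspanM (chiD z0) (@nonneg_offD _ setT)); first exact: zspan_dyson.
apply: (mspan_prod (chiD z0) (chi0 z)); [exact: nonneg_off0|exact: nonneg_offD|].
by move=> j _; exact: zspan_hsym_nonneg_off.
Qed.

End Linking.

(** * Algebraic independence of the variables *)

Section LaurentIndependence.
Variables (K : fieldType) (n : nat).
Local Notation Om := {fraction {mpoly K[n]}}.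

Definition mconst : {rmorphism K -> Om} :=
  (@FracField.tofrac {mpoly K[n]} \o @mpolyC n K)%FUN.

Definition mvar (k : 'I_n) : Om := ('X_k : {mpoly K[n]})%:F.

Lemma mvar_neq0 k : mvar k != 0.
Proof.
rewrite tofrac_eq0; apply/eqP => /(congr1 (mcoeff U_(k))).
by rewrite mcoeffX eqxx mcoeff0 => /eqP; rewrite oner_eq0.
Qed.

(** Multiplying by a large power [M] of every variable makes all exponents nonnegative, and
    coefficients are then compared in the polynomial ring. *)
Lemma laurent_indep : lin_indep mconst (chi mvar).
Proof.
move=> l l0 e.
pose M := (\sum_(x <- l) \sum_k `|x.2 k| + \sum_k `|e k|)%N.
have Ml x k : x \in l -> 0 <= x.2 k + M%:Z.
  move=> xl; suff : (`|x.2 k| <= M)%N by lia.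
  rewrite /M (big_rem x) //= (bigD1 k) //=; lia.
have Me k : 0 <= e k + M%:Z.
  suff : (`|e k| <= M)%N by lia.
  rewrite /M [X in (_ <= _ + X)%N](bigD1 k) //=; lia.
pose mn (f : {ffun 'I_n -> int}) : 'X_{1..n} := [multinom `|(f k + M%:Z)%R|%N | k < n].
have : \sum_(x <- l) mconst x.1 * chi mvar x.2 * chi mvar [ffun=> M%:Z] = 0.
  by rewrite -big_distrl l0 /= mul0r.
have E x : x \in l -> mconst x.1 * chi mvar x.2 * chi mvar [ffun=> M%:Z]
    = (x.1 *: 'X_[mn x.2])%:F.
  move=> xl; rewrite -mulrA -chiD; last exact: mvar_neq0.
  rewrite -mul_mpolyC rmorphM; congr (_ * _).
  rewrite mpolyXE_id rmorph_prod; apply: eq_bigr => k _.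
  rewrite rmorphXn !ffunE mnmE [RHS]exprnP; congr (_ ^ _).
  by rewrite gez0_abs ?Ml.
rewrite (eq_big_seq _ E) -rmorph_sum => /eqP; rewrite tofrac_eq0 => /eqP.
move/(congr1 (mcoeff (mn e))); rewrite raddf_sum mcoeff0 /= => S.
rewrite -[RHS]S big_mkcond; apply: eq_big_seq => x xl.
rewrite mcoeffZ mcoeffX.
suff -> : (mn x.2 == mn e) = (x.2 == e) by case: eqP; rewrite ?mulr1 ?mulr0.
apply/eqP/eqP => [mE|->//]; apply/ffunP => k.
have := congr1 (fun m : 'X_{1..n} => m k) mE; rewrite !mnmE.
by move/(congr1 Posz); rewrite !gez0_abs ?Ml // => /addIr.
Qed.

End LaurentIndependence.

Section JointIndependence.
Variables (K : fieldType) (s t : nat).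
Let z (i : 'I_s) : {fraction {mpoly K[s + t]}} := mvar K (lshift t i).
Let w (j : 'I_t) : {fraction {mpoly K[s + t]}} := mvar K (rshift s j).

Lemma joint_indep : lin_indep (@mconst K (s + t)) (chij z w).
Proof.
pose join (x : mon s t) : {ffun 'I_(s + t) -> int} :=
  [ffun k => match split k with inl i => x.1 i | inr j => x.2 j end].
have joinl x i : join x (lshift t i) = x.1 i by rewrite ffunE (unsplitK (inl i)).
have joinr x j : join x (rshift s j) = x.2 j by rewrite ffunE (unsplitK (inr j)).
have chi_join x : chi (@mvar K (s + t)) (join x) = chij z w x.
  rewrite /chi big_split_ord; congr (_ * _); apply: eq_bigr => i _.
    by rewrite joinl.
  by rewrite joinr.
move=> l l0 e; pose l' := [seq (x.1, join x.2) | x <- l].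
have l'0 : \sum_(x <- l') mconst K (s + t) x.1 * chi (@mvar K (s + t)) x.2 = 0.
  by rewrite -[RHS]l0 big_map; apply: eq_bigr => x _; rewrite /= chi_join.
rewrite -[RHS](laurent_indep l'0 (join e)) big_map /=; apply: eq_bigl => x.
apply/eqP/eqP => [-> //|jE]; rewrite [LHS]surjective_pairing [RHS]surjective_pairing.
by congr (_, _); apply/ffunP => i; [rewrite -!joinl jE|rewrite -!joinr jE].
Qed.

End JointIndependence.

Lemma tofrac_inj (R : idomainType) : injective (@FracField.tofrac R).
Proof. by move=> x y /eqP; rewrite tofrac_eq => /eqP. Qed.

Lemma sumn_absz (l : seq int) : (forall x, x \in l -> 0 <= x) ->
  (sumn (map absz l))%:Z = \sum_(x <- l) x.
Proof.
elim: l => [|x l IH] l0; first by rewrite big_nil.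
rewrite big_cons /= PoszD IH => [|u ul]; last by apply: l0; rewrite inE ul orbT.
by rewrite gez0_abs ?l0 ?mem_head.
Qed.

(** * Coefficients of the formal series *)

Section Coefficients.
Variables (s t : nat) (beta : 'I_s -> nat) (hbeta : forall i, (0 < beta i)%N).
Local Notation K := {fraction {poly int}}.
Local Notation jo := (@FracField.tofrac {poly int}).
Local Notation io := (@mconst K (s + t)).
Let z (i : 'I_s) := mvar K (lshift t i).
Let w (j : 'I_t) := mvar K (rshift s j).
Local Notation q := (jo 'X).

Let z0 i : z i != 0. Proof. exact: mvar_neq0. Qed.
Let w0 j : w j != 0. Proof. exact: mvar_neq0. Qed.
Let jo_inj : injective jo. Proof. exact: tofrac_inj. Qed.
Let indep := @joint_indep K s t.

(** The contrapositive of dominance for the selected parts [js]. The number [p] adds zero parts,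
    harmless because [hsym] in degree 0 is 1, to reach lengths beyond the number of parts of [m]. *)
Lemma Fcoef_dom (k : {ffun 'I_s -> int}) (m : 'I_t -> nat) (js rs : seq nat) p :
  perm_eq (js ++ rs) [seq m j | j <- enum 'I_t] ->
  ~ dom_on setT (size js + p) (sumn js) k ->
  Fcoef beta (k, [ffun j => - (m j)%:Z]) = 0.
Proof.
move=> pm nk; apply: jo_inj; rewrite rmorph0.
pose N := (\sum_(j < t) m j)%N.
apply: (Fcoef_mspan (N := N) z0 w0 indep (erefl _)).
rewrite rmorph0 mul0r subr0.
have mN j : (m j <= N)%N by rewrite /N (bigD1 j) //= leq_addr.
have : all (leq^~ N) (js ++ rs).
  by rewrite (perm_all _ pm); apply/allP => _ /mapP [j _ ->].
rewrite all_cat => /andP [jN rN].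
have jpN : all (leq^~ N) (js ++ nseq p 0%N).
  by rewrite all_cat jN; apply/allP => _ /nseqP [-> _].
have := zspan_dominance (io := io) z0 (q_neq0 jo_inj)
  (z_free jo_inj indep) hbeta setT jpN rN.
rewrite size_cat size_nseq sumn_cat sumn_nseq mul0n addn0.
have -> : dyson io z q beta setT * \prod_(m <- js ++ nseq p 0%N) hsym io z q beta N setT m
    * \prod_(m <- rs) hsym io z q beta N setT m
  = dyson io z q beta setT * \prod_j hsym io z q beta N setT (m j).
  rewrite big_cat /= [X in _ * (_ * X)]big1_seq ?mulr1.
    rewrite -mulrA -big_cat (perm_big _ pm) big_map.
    by rewrite big_enum.
  move=> d /andP [_ /nseqP [-> _]]; rewrite /hsym coef0_prod big1 // => i _.
  by rewrite coef0_prod big1 // => c _; rewrite coef_poly.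
by apply: mspanW => a ha ak; apply: nk; rewrite -ak.
Qed.

Lemma Fcoef_leading (b : nat) (lam : 'I_s -> nat) (m : 'I_t -> nat) :
  (forall i, beta i = b) ->
  (forall i j : 'I_s, (i <= j)%N -> (lam j <= lam i)%N) ->
  [seq m j | j <- enum 'I_t] = [seq lam i | i <- enum 'I_s] ->
  jo (Fcoef beta ([ffun i => (lam i)%:Z], [ffun j => - (m j)%:Z]))
  = clist q b [seq lam i | i <- enum 'I_s].
Proof.
move=> betab lam_dec E; pose N := (\sum_(j < t) m j)%N.
apply: (Fcoef_mspan (N := N) z0 w0 indep (erefl _)).
have lamN i : (lam i <= N)%N.
  have : lam i \in [seq m j | j <- enum 'I_t] by rewrite E map_f ?mem_enum.
  by move=> /mapP [j _ ->]; rewrite /N (bigD1 j) //= leq_addr.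
have := zspan_leading (io := io) z0 (q_neq0 jo_inj)
  (z_free jo_inj indep) hbeta betab lam_dec lamN setT.
have -> : [ffun i => (lam i)%:Z] = lam_on lam setT.
  by apply/ffunP => i; rewrite !ffunE in_setT.
have -> : enum [set: 'I_s] = enum 'I_s by apply: eq_enum => i; rewrite in_setT.
rewrite -E big_map big_enum /=.
exact.
Qed.

End Coefficients.

Theorem theorem4p7 (s t : nat) (hs : (0 < s)%N) (ht : (0 < t)%N)
  (beta : 'I_s -> nat) (hbeta : forall i, (0 < beta i)%N) :
  (forall (k : 'I_s -> int) (m : 'I_t -> nat),
      Fcoef beta ([ffun i => k i], [ffun j => - (m j)%:Z]) != 0 ->
      dominates (dec_sort [seq k i | i <- enum 'I_s])
                (dec_sort [seq (m j)%:Z | j <- enum 'I_t]))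
  /\
  (forall (b : nat) (est : s = t) (lam : 'I_s -> nat),
      (forall i, beta i = b) ->
      (forall i j : 'I_s, (i <= j)%N -> (lam j <= lam i)%N) ->
      (forall i, (0 < lam i)%N) ->
      (Fcoef beta ([ffun i => (lam i)%:Z],
                   [ffun j => - (lam (cast_ord (esym est) j))%:Z]))%:F
      = clam b lam).
Proof.
split=> [k m F0 n|b est lam betab lam_dec lam0]; last first.
  subst t; rewrite (_ : [ffun j => _] = [ffun j => - (lam j)%:Z]); last first.
    by apply/ffunP => j; rewrite !ffunE cast_ord_id.
  rewrite (Fcoef_leading hbeta betab lam_dec (erefl _)) /clam.
  set L := (\sum_(j < s) lam j)%N.
  have b0 : (0 < b)%N by rewrite -(betab (Ordinal hs)).
  rewrite (@clistE _ _ b L); last 2 first.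
  - have q1 := @q_free _ _ (@tofrac_inj _).
    rewrite subr_eq0 eq_sym; apply/eqP => /(q1 b 0%N) b_0.
    by rewrite b_0 in b0.
  - apply/allP => _ /mapP [j _ ->]; rewrite lam0 /L (bigD1 j) //= leq_addr //.
  have cm i : count_mem i [seq lam j | j <- enum 'I_s] = mult lam i.
    by rewrite count_map /mult cardE enumT [in RHS]/enum_mem size_filter; exact: eq_count.
  rewrite size_map size_enum_ord.
  congr (_ * _ * _).
  - congr (_ ^+ (_ * (_ - _) %/ 2)); apply: eq_bigr => i _; by rewrite cm.
  - by apply: eq_bigr => i _; rewrite cm.
  apply: eq_bigr => i _; rewrite (nth_map i) ?size_enum_ord // nth_ord_enum //.
rewrite leNgt; apply/negP => lt; case/eqP: F0.
set a := dec_sort _ in lt; set c := dec_sort _ in lt.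
have pc : perm_eq c [seq (m j)%:Z | j <- enum 'I_t] by rewrite /c /dec_sort perm_sort.
have pa : perm_eq a [seq k i | i <- enum 'I_s] by rewrite /a /dec_sort perm_sort.
have sa : sorted (fun x y : int => y <= x) a.
  by apply: sort_sorted => x y; exact: le_total.
have c_ge0 x : x \in c -> 0 <= x by rewrite (perm_mem pc) => /mapP [j _ ->].
(* The largest [n] parts of [m], for an [n] at which the partial sums violate dominance. *)
pose js := map absz (take n c); pose rs := map absz (drop n c).
have jsE : (sumn js)%:Z = \sum_(l < n) nth 0 c l.
  by rewrite sum_nth_take sumn_absz // => x /mem_take; exact: c_ge0.
(* The [n - size js] added zeros match the padding by [nth 0] when [n] exceeds [t]. *)
apply: (@Fcoef_dom _ _ _ hbeta _ _ js rs (n - size js)%N).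
  rewrite -map_cat cat_take_drop; apply: perm_trans (perm_map absz pc) _.
  by rewrite -map_comp perm_refl.
move=> [_ [I [_ cI]]]; rewrite leNgt => /negP; apply; rewrite jsE.
apply: le_lt_trans lt; rewrite sum_nth_take.
have sI : (minn n s = size [seq k i | i <- enum I])%N.
  rewrite size_map -cardE cI cardsT card_ord subnKC // size_map.
  by rewrite size_take; case: ltnP.
(* If [n] exceeds [s], then [I] is everything and both truncations return all of [a]. *)
have -> : take n a = take (size [seq k i | i <- enum I]) a.
  rewrite -sI take_min; congr take; rewrite take_oversize //.
  by rewrite (perm_size pa) size_map size_enum_ord.
have -> : \sum_(i in I) [ffun i => k i] i = \sum_(x <- [seq k i | i <- enum I]) x.
  by rewrite big_map big_enum; apply: eq_bigr => i _; rewrite ffunE.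
(* The exponents outside [I] complete those in [I] to a rearrangement of [a]. *)
apply: (@top_sum _ _ [seq k i | i <- enum (~: I)]) => //.
rewrite perm_sym (perm_trans pa) // -map_cat perm_map // uniq_perm ?enum_uniq //.
  rewrite cat_uniq !enum_uniq andbT; apply/hasPn => i.
  by rewrite !mem_enum inE.
by move=> i; rewrite mem_cat !mem_enum in_setC orbN.
Qed.
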